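(* Let $R$ be a locally equidimensional universally catenary Noetherian ring, let $M$ be a finitely generated $R$-module, and let $U$ be a submodule of $M$ generated by $t$ elements. If there exists a minimal prime $Q$ of $R$ such that $M/QM$ (as a module over $R/Q$) is not integral over the image of $U$ in $M/QM$, then $$\operatorname{ht}(U:_RM)\le\max\{0,\,t+1-\mu_Q(M)\}.$$
   Context: $\mu_Q(M)$ is the minimal number of generators of $M_Q$ over $R_Q$; $U:_RM=\{r\in R\mid rM\subseteq U\}$. Rees algebra of a finitely generated module $M$ over a Noetherian ring $A$: choose an $A$-linear map $f:M\to F$ to a finitely generated free $A$-module with $f^*:F^*\to M^*$ surjective; $\mathcal R(M)$ is the image of $\operatorname{Sym}(f):\operatorname{Sym}(M)\to\operatorname{Sym}(F)$. For submodules $U\subseteq L\subseteq M$ with images $U',L'$ in degree one of $\mathcal R(M)$, $L$ is integral over $U$ in $M$ if the ring extension $A[U']\subseteq A[L']$ is integral; $M$ is integral over $U$ if $M$ is integral over $U$ in $M$. *)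

(* Defs.v *)
From HB Require Import structures.
From mathcomp Require Import all_boot all_order all_algebra.
From mathcomp Require Import mpoly.
Set Implicit Arguments. Unset Strict Implicit. Unset Printing Implicit Defensive.
Import GRing.Theory.
Local Open Scope ring_scope.

Definition subp {T : Type} (P P' : T -> Prop) := forall x, P x -> P' x.
Definition peq {T : Type} (P P' : T -> Prop) := forall x, P x <-> P' x.
Definition botp {T : Type} : T -> Prop := fun _ => False.

Section Ideals.
Variable S : comPzRingType.

Definition is_ideal (I : S -> Prop) :=
  [/\ I 0, (forall x y, I x -> I y -> I (x + y)) & (forall r x, I x -> I (r * x))].

Definition is_prime (I : S -> Prop) :=
  [/\ is_ideal I, ~ I 1 & (forall x y, I (x * y) -> I x \/ I y)].

Definition is_maximal (I : S -> Prop) :=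
  [/\ is_ideal I, ~ I 1 &
      (forall J, is_ideal J -> ~ J 1 -> subp I J -> subp J I)].

Definition is_minimal_prime (P : S -> Prop) :=
  is_prime P /\ (forall P', is_prime P' -> subp P' P -> subp P P').

Definition prime_chain (C : nat -> S -> Prop) (n : nat) :=
  (forall i, (i <= n)%N -> is_prime (C i)) /\
  (forall i, (i < n)%N -> subp (C i) (C i.+1) /\ ~ subp (C i.+1) (C i)).

Definition has_chain_len (lo hi : S -> Prop) (n : nat) :=
  exists C, prime_chain C n /\
            (forall i, (i <= n)%N -> subp lo (C i) /\ subp (C i) hi).

Definition height_le (I : S -> Prop) (k : nat) :=
  exists P, [/\ is_prime P, subp I P & ~ has_chain_len botp P k.+1].

Definition saturated_chain (P P' : S -> Prop) (C : nat -> S -> Prop) n :=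
  [/\ prime_chain C n, peq (C 0%N) P, peq (C n) P' &
      forall i, (i < n)%N -> forall P0, is_prime P0 ->
        subp (C i) P0 -> subp P0 (C i.+1) -> peq P0 (C i) \/ peq P0 (C i.+1)].

Definition catenary :=
  forall P P', is_prime P -> is_prime P' -> subp P P' ->
    exists k, ~ has_chain_len P P' k.+1 /\
              (forall C n, saturated_chain P P' C n -> n = k).

Definition noetherian :=
  forall I, is_ideal I -> exists n (g : 'I_n -> S),
    forall x, I x <-> exists c : 'I_n -> S, x = \sum_(i < n) c i * g i.

End Ideals.

Definition fg_algebra (R S : comPzRingType) (phi : {rmorphism R -> S}) :=
  exists n (s : 'I_n -> S), forall y (P : S -> Prop),
    (forall r, P (phi r)) -> (forall i, P (s i)) ->
    (forall x z, P x -> P z -> P (x + z)) ->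
    (forall x z, P x -> P z -> P (x * z)) -> P y.

Definition universally_catenary (R : comPzRingType) :=
  forall (S : comPzRingType) (phi : {rmorphism R -> S}),
    fg_algebra phi -> catenary S.

(* for every maximal m and minimal prime p ⊆ m : dim R_m <= dim R_m/pR_m
   (the reverse inequality is automatic), phrased through the
   correspondence between primes of R_m (resp. R_m/pR_m) and primes of R
   contained in m (resp. between p and m) *)
Definition locally_equidimensional (R : comPzRingType) :=
  forall m p : R -> Prop, is_maximal m -> is_minimal_prime p -> subp p m ->
    forall n, has_chain_len botp m n -> has_chain_len p m n.

Section Modules.
Variables (R : comPzRingType) (M : lmodType R).

Definition mspan n (g : 'I_n -> M) (x : M) :=
  exists c : 'I_n -> R, x = \sum_(i < n) c i *: g i.

Definition fg_module := exists n (g : 'I_n -> M), forall x, mspan g x.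

Definition colon (U : M -> Prop) (r : R) := forall m : M, U (r *: m).

(* M_Q is generated by n elements over R_Q *)
Definition loc_generated (Q : R -> Prop) (n : nat) :=
  exists g : 'I_n -> M, forall m, exists s, ~ Q s /\ mspan g (s *: m).

Definition is_mu (Q : R -> Prop) (mu : nat) :=
  loc_generated Q mu /\ (forall n, loc_generated Q n -> (mu <= n)%N).

Definition QM (Q : R -> Prop) (x : M) :=
  exists k (q : 'I_k -> R) (m : 'I_k -> M),
    (forall i, Q (q i)) /\ x = \sum_(i < k) q i *: m i.

Definition is_quotient_ring (Q : R -> Prop) (A : comNzRingType)
  (pi : {rmorphism R -> A}) :=
  (forall a, exists r, pi r = a) /\ (forall r, pi r = 0 <-> Q r).

Definition is_quotient_module (Q : R -> Prop) (A : comNzRingType)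
  (pi : {rmorphism R -> A}) (N : lmodType A) (p : M -> N) :=
  [/\ forall x y, p (x + y) = p x + p y,
      forall r x, p (r *: x) = pi r *: p x,
      forall y, exists x, p x = y &
      forall x, p x = 0 <-> QM Q x].
End Modules.

Section Rees.
Variables (A : comNzRingType) (N : lmodType A).

Definition lin_form (h : N -> A) :=
  forall a x y, h (a *: x + y) = a * h x + h y.

(* f : N -> F = A^n is A-linear and f^* : F^* -> N^* is surjective *)
Definition rees_embedding n (f : N -> 'I_n -> A) :=
  (forall i, lin_form (fun x => f x i)) /\
  (forall h, lin_form h -> exists c : 'I_n -> A,
      forall x, h x = \sum_(i < n) c i * f x i).

(* element of degree one of Sym(F) = A[T_1..T_n] *)
Definition lform n (v : 'I_n -> A) : {mpoly A[n]} :=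
  \sum_(i < n) v i *: 'X_i.

Definition gen_subalg n (Sg : {mpoly A[n]} -> Prop) (q : {mpoly A[n]}) :=
  forall P : {mpoly A[n]} -> Prop,
    (forall a, P a%:MP) -> (forall q', Sg q' -> P q') ->
    (forall x z, P x -> P z -> P (x + z)) ->
    (forall x z, P x -> P z -> P (x * z)) -> P q.

Definition integral_over_sub (T : comPzRingType) (B : T -> Prop) (x : T) :=
  exists d (c : nat -> T), (forall i, B (c i)) /\
    x ^+ d + \sum_(i < d) c i * x ^+ i = 0.

(* L is integral over U in N: A[U'] ⊆ A[L'] is integral, where U', L'
   are the degree-one images in R(N) ⊆ Sym(F) (for any admissible f) *)
Definition integral_in (U L : N -> Prop) :=
  forall n (f : N -> 'I_n -> A), rees_embedding f ->
  forall q, gen_subalg (fun q' => exists x, L x /\ q' = lform (f x)) q ->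
    integral_over_sub
      (gen_subalg (fun q' => exists x, U x /\ q' = lform (f x))) q.
End Rees.

(* Main.v *)
(* Modulo [Q] the ring is a universally catenary domain [A], and torsion can be ignored since
   the Rees algebra is built from linear forms.  If some degree-one element [b] is not integral
   over [C = A[U']], then [1/b] is not a unit of the domain [D = C[1/b]], so by Krull's principal
   ideal theorem it lies in a prime [P] of height one.  Its contraction to [A] contains
   [U : M], because [r * b] in [C] gives [r = (r * b) * (1/b)].  Adjoin to [A] the [t] generators
   of [U] and then [1/b], one at a time: in [S[X]], catenarity together with the fact that no
   prime lies strictly between [K[X]] and a prime contracting to [K] shows that an algebraic
   step loses at most one in the height of the contracted prime and a transcendental step none.
   At least [mu] steps are transcendental (the transcendental generators generate [M_Q] by
   Nakayama), and at the last step nothing is lost since [P] contains the variable [1/b]. *)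

(* Quotients and localizations are kept out of the height computations. Each intermediate domain is
   represented by an iterated polynomial ring [S] over A together with the kernel K of an evaluation
   map; its primes are the primes of [S] containing K, and heights are lengths of chains starting at
   K. The loss at an algebraic step is then read off in S[X], where the new kernel lies at most one
   step above K[X]. Linear dependence decides algebraic dependence. If a nonzero multiple of a new
   generator u lies in the span of the earlier ones, this is a relation of degree one. Otherwise
   some linear form on N kills the earlier generators but not u; surjectivity of f^* writes it in
   the coordinates of F, and the resulting translation of the variables of Sym(F) fixes the earlier
   subalgebra and moves u, so u is transcendental. The adjunction is carried out when U:M is not
   inside Q. Otherwise Q, of height zero, already contains U:M. *)
Require Import Defs.
From HB Require Import structures.
From mathcomp Require Import all_boot all_order all_algebra.
From mathcomp Require Import mpoly.
From mathcomp Require Import ring zify.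
From Stdlib Require Import Classical ClassicalEpsilon.
Set Implicit Arguments. Unset Strict Implicit. Unset Printing Implicit Defensive.
Import GRing.Theory.
Local Open Scope ring_scope.

(** * Submodules and Noetherian rings *)

Section Submodules.
Variables (S : comPzRingType) (M : lmodType S).
Implicit Types (V Z : M -> Prop) (p : S -> Prop) (s : seq M).

Definition is_submod V :=
  [/\ V 0, (forall x y, V x -> V y -> V (x + y)) & (forall r x, V x -> V (r *: x))].

(** For an ideal [p] this is [p] times the span of [s], the error term in Nakayama's lemma. The
    impredicative form doubles as an induction principle for membership. *)
Definition pspan p s (x : M) :=
  forall V, is_submod V -> (forall c y, p c -> y \in s -> V (c *: y)) -> V x.

Definition span s := pspan (fun _ => True) s.

Lemma pspan_submod p s : is_submod (pspan p s).
Proof.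
split.
- by move=> V [].
- by move=> x y hx hy V hV h; case: (hV) => _ VD _; apply: VD; [apply: hx|apply: hy].
- by move=> r x hx V hV h; case: (hV) => _ _ VZ; apply: VZ; apply: hx.
Qed.

Lemma pspan_scale p s c x : p c -> x \in s -> pspan p s (c *: x).
Proof. by move=> pc xs V hV; apply. Qed.

Lemma span_mem s x : x \in s -> span s x.
Proof. by move=> xs; rewrite -[x]scale1r; apply: pspan_scale. Qed.

Lemma span_min s V : is_submod V -> (forall x, x \in s -> V x) -> forall x, span s x -> V x.
Proof.
by move=> hV h x sx; apply: (sx V) => // c y _ ys; case: (hV) => _ _ VZ; apply/VZ/h.
Qed.

Lemma span_subset s s' : {subset s <= s'} -> forall x, span s x -> span s' x.
Proof.
move=> ss; apply: (@span_min s (span s')); first exact: pspan_submod.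
by move=> x xs; apply: span_mem; apply: ss.
Qed.

Lemma pspan_cons p x s w : is_ideal p ->
  pspan p (x :: s) w -> exists2 c, p c & pspan p s (w - c *: x).
Proof.
case=> p0 pD pM; have [P0 PD PZ] := pspan_submod p s.
move=> hw; apply: (hw (fun w => exists2 c, p c & pspan p s (w - c *: x))) => [|c y pc]; first split.
- by exists 0; rewrite ?scale0r ?subr0.
- move=> v1 v2 [c1 pc1 h1] [c2 pc2 h2]; exists (c1 + c2); first exact: pD.
  by rewrite scalerDl opprD addrACA; apply: PD.
- move=> r v [c pc h]; exists (r * c); first exact: pM.
  by rewrite -scalerA -scalerBr; apply: PZ.
rewrite inE => /orP[/eqP->|ys]; first by exists c; rewrite ?subrr.
by exists 0; rewrite ?scale0r ?subr0 //; apply: pspan_scale.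
Qed.

Lemma span_mspan s x : span s x <-> mspan (fun i : 'I_(size s) => s`_i) x.
Proof.
split=> [sx|[c ->]].
- apply: (sx (mspan (fun i : 'I_(size s) => s`_i))).
    split; first by exists (fun _ => 0); rewrite big1 // => i _; rewrite scale0r.
    + move=> y z [c ->] [d ->]; exists (fun i => c i + d i).
      by rewrite -big_split; apply: eq_bigr => i _; rewrite scalerDl.
    + move=> r y [c ->]; exists (fun i => r * c i).
      by rewrite scaler_sumr; apply: eq_bigr => i _; rewrite scalerA.
  move=> c y _ ys; have lt : (index y s < size s)%N by rewrite index_mem.
  exists (fun i => if i == Ordinal lt then c else 0).
  rewrite (bigD1 (Ordinal lt)) //= eqxx nth_index // big1 ?addr0 //.
  by move=> j /negPf->; rewrite scale0r.
- have [S0 SD SZ] := pspan_submod (fun _ => True) s.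
  by apply: big_ind => // i _; apply: SZ; apply: span_mem; apply: mem_nth.
Qed.

Lemma add_submod V V' : is_submod V -> is_submod V' ->
  is_submod (fun x => exists2 v, V v & V' (x - v)).
Proof.
move=> [V0 VD VZ] [W0 WD WZ]; split.
- by exists 0; rewrite ?subr0.
- by move=> x y [v Vv h] [w Vw h']; exists (v + w); [exact: VD|rewrite opprD addrACA; exact: WD].
- by move=> r x [v Vv h]; exists (r *: v); [exact: VZ|rewrite -scalerBr; exact: WZ].
Qed.

(* Nakayama at the prime [p], by eliminating one generator at a time. *)
Lemma nakayama p s Z : is_prime p -> is_submod Z ->
    (forall x, x \in s -> exists2 a, ~ p a & exists2 z, Z z & pspan p s (a *: x - z)) ->
  exists2 d, ~ p d & forall x, x \in s -> Z (d *: x).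
Proof.
move=> [pI p1 pM] hZ; case: (pI) => p0 pD pMl.
elim: s => [|x s IH] h; first by exists 1.
have sZ := add_submod hZ (pspan_submod p s); case: (sZ) => _ sZD sZM.
have [a pa [z Zz /(pspan_cons pI)[c pc hx]]] := h x (mem_head _ _).
have pac : ~ p (a - c).
  by move=> h1; apply: pa; rewrite -[a](subrK c); apply: pD.
have hacx : exists2 v, Z v & pspan p s ((a - c) *: x - v).
  by exists z; rewrite // scalerBl addrAC.
have [|d pd hd] := IH.
  move=> y ys; have [|b pb [z' Zz' /(pspan_cons pI)[e pe hy]]] := h y.
    by rewrite inE ys orbT.
  exists ((a - c) * b); first by move/pM=> [].
  suff: exists2 v, Z v & pspan p s (((a - c) * b) *: y - v) by [].
  have -> : ((a - c) * b) *: y = (a - c) *: (b *: y - e *: x) + e *: ((a - c) *: x).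
    by rewrite scalerBr !scalerA [e * _]mulrC subrK.
  apply: sZD; last exact: sZM.
  by apply: sZM; exists z'; rewrite // addrAC.
exists (d * (a - c)); first by move/pM=> [].
case: (hZ) => _ ZD ZM.
move=> y; rewrite inE => /orP[/eqP->|ys]; last by rewrite mulrC -scalerA; apply/ZM/hd.
have [v Zv hv] := hacx; rewrite -scalerA -[_ *: x](subrK v) scalerDr.
apply: (ZD); last exact: (ZM).
apply: (hv (fun w => Z (d *: w))); last by move=> k w _ ws; rewrite scalerA mulrC -scalerA; apply/ZM/hd.
split; first by rewrite scaler0; case: hZ.
- by move=> u w; rewrite scalerDr; apply: ZD.
- by move=> r w; rewrite scalerA mulrC -scalerA; apply: ZM.
Qed.

End Submodules.

Section Noetherian.
Variable S : comPzRingType.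
Implicit Types (I J K : S -> Prop) (s : seq S).

Definition igen s : S -> Prop := @span S S^o s.

Lemma igen_ideal s : is_ideal (igen s).
Proof. exact: (@pspan_submod S S^o). Qed.

Lemma igen_min s I : is_ideal I -> (forall x, x \in s -> I x) -> subp (igen s) I.
Proof. by move=> hI h x; apply: (@span_min S S^o s I). Qed.

Lemma igen_mem s x : x \in s -> igen s x.
Proof. exact: (@span_mem S S^o). Qed.

Lemma igen_subset s s' : {subset s <= s'} -> subp (igen s) (igen s').
Proof. exact: (@span_subset S S^o). Qed.

(** The ascending chain condition phrased with elements only, a form that passes easily to quotients
    and polynomial rings. *)
Definition acc_seq := forall a : nat -> S, exists m, igen [seq a i | i <- iota 0 m] (a m).

Lemma noetherian_acc : noetherian S -> acc_seq.
Proof.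
move=> noeS a; pose I x := exists m, igen [seq a i | i <- iota 0 m] x.
have mono m m' x : (m <= m')%N -> igen [seq a i | i <- iota 0 m] x -> igen [seq a i | i <- iota 0 m'] x.
  move=> le; apply: igen_subset => y /mapP[i]; rewrite mem_iota => /andP[_ h] ->.
  by apply: map_f; rewrite mem_iota /=; lia.
have hI : is_ideal I.
  split; first by exists 0; case: (igen_ideal [::]).
  - move=> x y [m hx] [m' hy]; exists (maxn m m').
    have [_ D _] := igen_ideal [seq a i | i <- iota 0 (maxn m m')].
    by apply: D; [apply: mono hx|apply: mono hy]; lia.
  - by move=> r x [m hx]; exists m; have [_ _ Z] := igen_ideal [seq a i | i <- iota 0 m]; apply: Z.
have [n [g hg]] := noeS I hI.
have gI i : I (g i).
  apply/hg; exists (fun j => (j == i)%:R); rewrite (bigD1 i) //= eqxx mul1r big1 ?addr0 //.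
  by move=> j /negPf->; rewrite mul0r.
have [m hm] : exists m, forall i, igen [seq a i | i <- iota 0 m] (g i).
  have := fun i => constructive_indefinite_description _ (gI i) => h.
  exists (\max_i sval (h i)) => i; apply: mono (svalP (h i)).
  exact: leq_bigmax.
exists m; have /hg[c ->] : I (a m).
  exists m.+1; apply: igen_mem; apply: map_f; rewrite mem_iota /=; lia.
have [Z0 ZD ZM] := igen_ideal [seq a i | i <- iota 0 m].
apply: big_ind => // i _; apply: ZM; apply: hm.
Qed.

(* Repeatedly choosing [F s] outside the ideal generated by [s] contradicts [acc_seq]. *)
Lemma acc_absurd (F : seq S -> S) : acc_seq ->
  exists n, let s := iter n (fun s => rcons s (F s)) [::] in igen s (F s).
Proof.
move=> acc; pose g n := iter n (fun s => rcons s (F s)) [::].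
have [m hm] := acc (fun n => F (g n)); exists m => /=; rewrite -/(g m).
suff e : g m = [seq F (g i) | i <- iota 0 m] by rewrite {1}e.
elim: m {hm} => // m IH; rewrite -(addn1 m) iotaD map_cat cats1 -IH.
by rewrite addn1.
Qed.

Lemma acc_fg I : acc_seq -> is_ideal I ->
  exists s, (forall x, x \in s -> I x) /\ subp I (igen s).
Proof.
move=> acc hI; apply: NNPP => h.
have ex s : exists x, (forall x, x \in s -> I x) -> I x /\ ~ igen s x.
  apply: NNPP => h1; apply: h; exists s.
  have h2 : forall x, x \in s -> I x.
    by apply: NNPP => h2; apply: h1; exists 0.
  by split=> // x Ix; apply: NNPP => h3; apply: h1; exists x.
pose F s := sval (constructive_indefinite_description _ (ex s)).
have FP s := svalP (constructive_indefinite_description _ (ex s)).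
have [n /=] := acc_absurd F acc; set s := iter _ _ _.
have sI : forall x, x \in s -> I x.
  rewrite {}/s; elim: n => //= n IH x; rewrite mem_rcons inE => /orP[/eqP->|/IH//].
  by have [] := FP _ IH.
by have [_] := FP s sI.
Qed.

Lemma acc_noetherian : (forall I, is_ideal I ->
  exists s, (forall x, x \in s -> I x) /\ subp I (igen s)) -> noetherian S.
Proof.
move=> fg I hI; have [s [sI Is]] := fg I hI; have [I0 ID IM] := hI.
exists (size s), (fun i => s`_i) => x; split; first by move=> /Is/(@span_mspan S S^o).
by move=> [c ->]; apply: big_ind => // i _; apply: IM; apply: sI; apply: mem_nth.
Qed.

(** By dependent choice a counterexample starts a strictly increasing sequence of ideals; elements
    picked in the successive differences contradict [acc_seq]. *)
Lemma noetherian_ind (P : (S -> Prop) -> Prop) : acc_seq ->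
    (forall I, is_ideal I -> (forall J, is_ideal J -> subp I J -> ~ subp J I -> P J) -> P I) ->
  forall I, is_ideal I -> P I.
Proof.
move=> acc step I hI; apply: NNPP => nPI.
pose bad := {I | is_ideal I /\ ~ P I}.
have ex (B : bad) : exists C : bad, subp (sval B) (sval C) /\ exists x, sval C x /\ ~ sval B x.
  case: B => J [hJ nPJ] /=; apply: NNPP => h; apply: nPJ; apply: step => // J' hJ' JJ' nJ'J.
  apply: NNPP => nPJ'; apply: h; exists (exist _ J' (conj hJ' nPJ')); split=> //=.
  apply: NNPP => h; apply: nJ'J => x J'x; apply: NNPP => nJx; apply: h; by exists x.
pose nx B := sval (constructive_indefinite_description _ (ex B)).
have nxP B := svalP (constructive_indefinite_description _ (ex B)).
pose C n := iter n nx (exist _ I (conj hI nPI)).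
have exa n : exists x, sval (C n.+1) x /\ ~ sval (C n) x by case: (nxP (C n)).
pose a n := sval (constructive_indefinite_description _ (exa n)).
have aP n := svalP (constructive_indefinite_description _ (exa n)).
have mono m n : (m <= n)%N -> subp (sval (C m)) (sval (C n)).
  move=> /subnK <-; elim: (n - m)%N => // k IH x /IH; rewrite addSn.
  by have [h _] := nxP (C (k + m)); apply: h.
have [m] := acc a; have [_ nCa] := aP m => h; apply: nCa.
have [hC _] := svalP (C m); move: h; apply: igen_min => // x /mapP[i].
rewrite mem_iota => /andP[_ lt] ->; have [h _] := aP i; apply: mono h; lia.
Qed.

Lemma acc_maximal I : acc_seq -> is_ideal I -> ~ I 1 ->
  exists m, is_maximal m /\ subp I m.
Proof.
move=> acc hI; move: I hI.
apply: (noetherian_ind (P := fun I => ~ I 1 -> exists m, is_maximal m /\ subp I m)) => //.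
move=> I hI IH nI1.
have [[J [hJ IJ nJI nJ1]]|h] := classic (exists J, [/\ is_ideal J, subp I J, ~ subp J I & ~ J 1]).
  have [m [hm Jm]] := IH J hJ IJ nJI nJ1; exists m; split=> // x /IJ; exact: Jm.
exists I; split=> //; split=> // J hJ nJ1 IJ; apply: NNPP => nJI; apply: h; by exists J.
Qed.

Lemma maximal_prime I : is_maximal I -> is_prime I.
Proof.
move=> [hI nI1 mx]; split=> // x y Ixy; apply: NNPP => /not_or_and[nx ny].
have [I0 ID IM] := hI.
pose J z := exists c, I (z - c * x).
have hJ : is_ideal J.
  split; first by exists 0; rewrite mul0r subr0.
  - by move=> a b [c h] [d h']; exists (c + d); rewrite mulrDl opprD addrACA; exact: ID.
  - by move=> r a [c h]; exists (r * c); rewrite -mulrA -mulrBr; exact: IM.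
have IJ : subp I J by move=> z; exists 0; rewrite mul0r subr0.
have [c hc] : J 1.
  apply: NNPP => nJ1; apply: nx; apply: (mx J) => //; exists 1.
  by rewrite mul1r subrr.
apply: ny; have -> : y = y * (1 - c * x) + c * (x * y) by ring.
by apply: ID; apply: IM.
Qed.

Lemma acc_prime I : acc_seq -> is_ideal I -> ~ I 1 -> exists P, is_prime P /\ subp I P.
Proof.
move=> acc hI n1; have [m [hm h]] := acc_maximal acc hI n1; exists m.
by split=> //; apply: maximal_prime.
Qed.

End Noetherian.

(** * Chains of primes and Krull's principal ideal theorem *)

Section Chains.
Variable S : comPzRingType.
Implicit Types (P lo hi : S -> Prop) (C : nat -> S -> Prop).

Definition chain_length P P' n := has_chain_len P P' n /\ ~ has_chain_len P P' n.+1.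

Lemma has_chain_len_le lo hi n m : (m <= n)%N ->
  has_chain_len lo hi n -> has_chain_len lo hi m.
Proof.
move=> le [C [[CP CS] h]]; exists C; split; last by move=> i ile; apply: h; lia.
by split=> i ile; [apply: CP|apply: CS]; lia.
Qed.

Lemma chain_length_max P P' n h : chain_length P P' n -> has_chain_len P P' h -> (h <= n)%N.
Proof.
move=> [_ mx] hc; rewrite leqNgt; apply/negP => lt; apply: mx.
exact: has_chain_len_le hc.
Qed.

Lemma has_chain_len_mono lo hi lo' hi' n : subp lo' lo -> subp hi hi' ->
  has_chain_len lo hi n -> has_chain_len lo' hi' n.
Proof.
move=> hlo hhi [C [hC h]]; exists C; split=> // i ile; have [h1 h2] := h i ile.
by split=> x; [move/hlo/h1|move/h2/hhi].
Qed.

Lemma has_chain_len1 P P' : is_prime P -> is_prime P' -> subp P P' -> ~ subp P' P ->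
  has_chain_len P P' 1.
Proof.
move=> hP hP' PP' nP'P; exists (fun i => if i == 0%N then P else P'); split.
  by split=> -[|[|i]] //= _.
by move=> [|[|i]] //= _; split.
Qed.

Definition glue n C C' i := if (i <= n)%N then C i else C' (i - n)%N.

Lemma glueR n C C' i : peq (C n) (C' 0%N) -> (n <= i)%N -> peq (glue n C C' i) (C' (i - n)%N).
Proof.
rewrite /glue => h le x; case: ifP => // ge.
by have -> : i = n by [lia]; rewrite subnn.
Qed.

Lemma glue_chain n m C C' : subp (C n) (C' 0%N) -> prime_chain C n -> prime_chain C' m ->
  prime_chain (glue n C C') (n + m).
Proof.
move=> h0 [CP CS] [CP' CS']; split=> i ile; rewrite /glue.
  by case: ifP => h; [apply: CP|apply: CP'; lia].
case: (ltngtP i n) => h; first exact: CS.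
- by rewrite subSn; [apply: CS'; lia|lia].
- rewrite h subSnn; have [|h1 h2] := CS' 0%N; first by lia.
  by split=> [x /h0/h1//|h3]; apply: h2 => x /h3/h0.
Qed.

Lemma has_chain_len_cat P P' P'' n m : has_chain_len P P' n -> has_chain_len P' P'' m ->
  has_chain_len P P'' (n + m).
Proof.
move=> [C [hC h]] [C' [hC' h']].
have h0 : subp (C n) (C' 0%N).
  by move=> x /(proj2 (h n (leqnn n)))/(proj1 (h' 0%N (leq0n m))).
have hg := glue_chain h0 hC hC'.
exists (glue n C C'); split=> // i ile; rewrite /glue; case: ifP => le.
  have [h1 h2] := h i le; split=> // x /h2 /(proj1 (h' 0%N (leq0n m))).
  exact: (proj2 (h' 0%N (leq0n m))).
have [|h1 h2] := h' (i - n)%N; first by lia.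
split=> // x /(proj1 (h 0%N (leq0n n)))/(proj2 (h 0%N (leq0n n))); exact: h1.
Qed.

Lemma saturated_chain_cat P P' P'' C C' n m :
  saturated_chain P P' C n -> saturated_chain P' P'' C' m ->
  exists C'', saturated_chain P P'' C'' (n + m).
Proof.
move=> [hC C0 Cn Cs] [hC' C0' Cm Cs'].
have h0 : peq (C n) (C' 0%N) by move=> x; rewrite Cn -C0'.
exists (glue n C C'); split.
- by apply: glue_chain => // x /h0.
- by rewrite /glue.
- by move=> x; rewrite (glueR h0) ?leq_addr // addKn.
- move=> i lt P0 hP0; case: (ltnP i n) => [h|h].
    by rewrite /glue (ltnW h) h; apply: Cs.
  move=> h1 h2; have hi := glueR h0 h; have hi1 := glueR h0 (leqW h); rewrite subSn // in hi1.
  have [|||h3|h3] := Cs' (i - n)%N _ P0 hP0; first by lia.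
  + by move=> x /hi/h1.
  + by move=> x /h2/hi1.
  + by left=> x; rewrite h3 hi.
  + by right=> x; rewrite h3 hi1.
Qed.

(** Induction on the bound [n]: a prime strictly between the ends cuts the interval in two, and each
    half has a smaller bound. *)
Lemma saturated_chain_exists n P P' : is_prime P -> is_prime P' -> subp P P' ->
  ~ has_chain_len P P' n.+1 -> exists C m, saturated_chain P P' C m.
Proof.
elim: n P P' => [|n IH] P P' hP hP' PP' nc.
all: have [P'P|nP'P] := classic (subp P' P).
1, 3: by exists (fun _ => P), 0%N; split=> // x; split=> [/PP'|/P'P].
  by case: nc; apply: has_chain_len1.
have [[P0 [hP0 h1 h2 h3 h4]]|h] := classic (exists P0, [/\ is_prime P0,
   subp P P0, subp P0 P', ~ subp P0 P & ~ subp P' P0]).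
  have [|C [m hC]] := IH P P0 hP hP0 h1.
    move=> hc; apply: nc; rewrite -addn1.
    exact: has_chain_len_cat hc (has_chain_len1 _ _ _ _).
  have [|C' [m' hC']] := IH P0 P' hP0 hP' h2.
    move=> hc; apply: nc; rewrite -(add1n n.+1).
    exact: has_chain_len_cat (has_chain_len1 _ _ _ _) hc.
  by have [C'' hC''] := saturated_chain_cat hC hC'; exists C'', (m + m')%N.
exists (fun i => if i == 0%N then P else P'), 1%N; split=> //.
  by split=> -[|[|i]] //= _.
move=> [|//] _ P0 hP0 /= h1 h2; apply: NNPP => /not_or_and[n1 n2].
apply: h; exists P0; split=> // h3; [apply: n1|apply: n2] => x; split; auto.
Qed.

(** Relative heights add up: two saturated chains glue to a saturated one, and catenarity makes the
    length of any saturated chain the maximal one. *)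
Lemma catenary_chain_length P P' P'' : catenary S ->
  is_prime P -> is_prime P' -> is_prime P'' -> subp P P' -> subp P' P'' ->
  exists n m, [/\ chain_length P P' n, chain_length P' P'' m & chain_length P P'' (n + m)].
Proof.
move=> cat hP hP' hP'' h1 h2.
have key P1 P2 : is_prime P1 -> is_prime P2 -> subp P1 P2 ->
    exists n, (exists C, saturated_chain P1 P2 C n) /\
      (forall C m, saturated_chain P1 P2 C m -> m = n) /\ chain_length P1 P2 n.
  move=> p1 p2 p12; have [k [hk ek]] := cat P1 P2 p1 p2 p12.
  (* A saturated chain has length exactly [k], so the bound [k] is attained. *)
  have [C [m hC]] := saturated_chain_exists p1 p2 p12 hk.
  have em := ek _ _ hC; exists m; split; first by exists C.
  rewrite em; split=> //; split=> //; exists C; rewrite -em.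
  case: hC => hC C0 Cm _; split=> // i ile; case: hC => [_ CS].
  have mono j l : (j + l <= m)%N -> subp (C j) (C (j + l)%N).
    elim: l => [|l IH] le; first by rewrite addn0.
    move=> x /IH h; rewrite addnS; have [|h' _] := CS (j + l)%N; first by lia.
    by apply: h'; apply: h; lia.
  split=> x; first by move=> /C0; have := mono 0%N i ile x.
  by move=> h; apply/Cm; have -> : m = (i + (m - i))%N by [lia]; apply: mono => //; lia.
have [n [[C hC] [_ ln]]] := key P P' hP hP' h1.
have [m [[C' hC'] [_ lm]]] := key P' P'' hP' hP'' h2.
have [|k [_ [ek lk]]] := key P P'' hP hP''; first by move=> x /h1/h2.
have [C'' hC''] := saturated_chain_cat hC hC'.
by exists n, m; split=> //; rewrite (ek _ _ hC'').
Qed.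

Lemma adjacent_chain_len P P' :
  (forall q, is_prime q -> subp P q -> subp q P' -> subp q P \/ subp P' q) ->
  ~ has_chain_len P P' 2.
Proof.
move=> adj [C [[CP CS] h]].
have [h0 _] := h 0%N isT; have [h1 h1'] := h 1%N isT; have [_ h2] := h 2%N isT.
have [_ n01] := CS 0%N isT; have [_ n12] := CS 1%N isT.
case: (adj _ (CP 1%N isT) h1 h1') => hh; [apply: n01|apply: n12] => x.
  by move=> /hh/h0.
by move=> /h2/hh.
Qed.

End Chains.

Section KrullPrincipal.
Variables (S : comPzRingType) (K Q : S -> Prop) (y : S).
Hypotheses (acc : acc_seq S) (Kprime : is_prime K) (Qprime : is_prime Q).
Hypotheses (KQ : subp K Q) (Qy : Q y).
Hypothesis Qmin : forall P, is_prime P -> subp K P -> P y -> subp P Q -> subp Q P.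

(* [S_Q / (K + y)] is Artinian; the localization at [Q] is expressed through multipliers [s]. *)
Lemma local_dcc I : is_ideal I -> subp K I -> I y ->
  forall J : nat -> S -> Prop, (forall n, is_ideal (J n)) ->
    (forall n m, (n <= m)%N -> subp (J m) (J n)) -> (forall n, subp I (J n)) ->
  exists n, forall m, (n <= m)%N -> forall x, J n x -> exists2 s, ~ Q s & J m (s * x).
Proof.
have [[Q0 QD QM] Q1 Qpr] := Qprime.
move: I; apply: (noetherian_ind acc) => I hI IH KI Iy J hJ Jdec IJ.
(* If [I] meets the complement of [Q], it becomes the unit ideal at [Q], and a single multiplier
   sends everything into it. *)
have [[s nQs Is]|IQ'] := classic (exists2 s, ~ Q s & I s).
  exists 0%N => m _ x _; exists s => //; have [_ _ JM] := hJ m.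
  by rewrite mulrC; apply: JM; apply: IJ.
have IQ : subp I Q by move=> x Ix; apply: NNPP => nQ; apply: IQ'; exists x.
have [I0 ID IM] := hI.
have [[a [b [na nb Iab]]]|Ipr] := classic (exists a b, [/\ ~ I a, ~ I b & I (a * b)]).
  (* Split S/I along multiplication by [a] into S/(I + (a)) and S/(I : a). Both ideals are strictly
     larger than [I], so by induction both induced sequences become stationary. *)
  pose plus (L : S -> Prop) z := exists2 v, L v & exists c, z - v = c * a.
  pose colon_a (L : S -> Prop) z := L (a * z).
  have plus_ideal L : is_ideal L -> is_ideal (plus L).
    move=> [L0 LD LM]; split.
    - by exists 0 => //; exists 0; rewrite mul0r subrr.
    - move=> z w [v Lv [c hc]] [v' Lv' [c' hc']]; exists (v + v'); first exact: LD.
      by exists (c + c'); rewrite mulrDl -hc -hc'; ring.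
    - by move=> r z [v Lv [c hc]]; exists (r * v); [exact: LM|exists (r * c); rewrite -mulrA -hc; ring].
  have colon_ideal L : is_ideal L -> is_ideal (colon_a L).
    move=> [L0 LD LM]; rewrite /colon_a; split; first by rewrite mulr0.
      by move=> z w hz hw; rewrite mulrDr; apply: LD.
    by move=> r z hz; rewrite mulrCA; apply: LM.
  have sub_plus L : subp L (plus L).
    by move=> x Lx; exists x => //; exists 0; rewrite mul0r subrr.
  have sub_colon L : is_ideal L -> subp L (colon_a L).
    by move=> [_ _ LM] x Lx; apply: LM.
  have [n1 h1] : exists n, forall m, (n <= m)%N -> forall x, plus (J n) x ->
      exists2 s, ~ Q s & plus (J m) (s * x).
    apply: (IH (plus I)) => //; first exact: plus_ideal.
    - by move=> h; apply: na; apply: h; exists 0 => //; exists 1; rewrite subr0 mul1r.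
    - by move=> x /KI; apply: sub_plus.
    - exact: sub_plus.
    - by move=> n; apply: plus_ideal.
    - by move=> n m le x [v Jv h]; exists v => //; apply: Jdec Jv.
    - by move=> n x [v Iv h]; exists v => //; apply: IJ.
  have [n2 h2] : exists n, forall m, (n <= m)%N -> forall x, colon_a (J n) x ->
      exists2 s, ~ Q s & colon_a (J m) (s * x).
    apply: (IH (colon_a I)) => //; first exact: colon_ideal.
    - exact: sub_colon.
    - by move=> h; apply: nb; apply: h.
    - by move=> x /KI; apply: sub_colon.
    - exact: sub_colon.
    - by move=> n; apply: colon_ideal.
    - by move=> n m le x; apply: Jdec.
    - by move=> n x; apply: IJ.
  pose n := maxn n1 n2; exists n => m le x Jx.
  have [n1n n2n] : (n1 <= n /\ n2 <= n)%N by split; rewrite /n; lia.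
  have [|s nQs [v Jv [c hc]]] := h1 m (leq_trans n1n le) x.
    by apply: sub_plus; apply: Jdec Jx.
  have [_ JD JM] := hJ n2.
  have [|s' nQs' Jc] := h2 m (leq_trans n2n le) c.
    rewrite /colon_a mulrC -hc; have -> : s * x - v = s * x + (-1) * v by ring.
    apply: JD; apply: JM; [exact: Jdec Jx|exact: (Jdec _ _ (leq_trans n2n le))].
  exists (s' * s); first by move/Qpr => [].
  have -> : s' * s * x = s' * v + a * (s' * c).
    by rewrite mulrCA [a * c]mulrC -hc; ring.
  by have [_ JmD JmM] := hJ m; apply: JmD => //; apply: JmM.
(* Now [I] is prime, hence equal to [Q] by minimality, and an ideal containing [Q] is locally either
   [Q] or the whole ring. *)
have QI : subp Q I.
  apply: Qmin => //; split=> //; first by move/IQ.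
  move=> a b Iab; apply: NNPP => /not_or_and[na nb]; apply: Ipr; by exists a, b.
have [[n JnQ]|h] := classic (exists n, subp (J n) Q).
  by exists n => m _ x /JnQ/QI/IJ h; exists 1; rewrite ?mul1r.
exists 0%N => m _ x _.
have [s Js nQs] : exists2 s, J m s & ~ Q s.
  apply: NNPP => h'; apply: h; exists m => s Js; apply: NNPP => nQs; apply: h'; by exists s.
by exists s => //; have [_ _ JM] := hJ m; rewrite mulrC; apply: JM.
Qed.

Variable q : S -> Prop.
Hypotheses (qprime : is_prime q) (Kq : subp K q) (qQ : subp q Q) (nqy : ~ q y).

Definition ideal_mul (I J : S -> Prop) z :=
  forall V, is_ideal V -> (forall c x, I c -> J x -> V (c * x)) -> V z.

(** The n-th symbolic power of [q] modulo [K], that is, the preimage in S of (q^n + K) S_q. *)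
Fixpoint symb n (x : S) : Prop :=
  if n is n'.+1 then
    exists2 s, ~ q s & exists2 k, K k & ideal_mul q (symb n') (s * x - k)
  else True.

Lemma ideal_mul_ideal I J : is_ideal (ideal_mul I J).
Proof.
split; first by move=> V [].
  by move=> a b ha hb V hV h; case: (hV) => _ VD _; apply: VD; [apply: ha|apply: hb].
by move=> r a ha V hV h; case: (hV) => _ _ VM; apply: VM; apply: ha.
Qed.

Lemma symb_ideal n : is_ideal (symb n).
Proof.
have [[K0 KD KM] K1 Kpr] := Kprime; have [[q0 qD qM] q1 qpr] := qprime.
case: n => [|n] //; have [M0 MD MM] := ideal_mul_ideal q (symb n); split => /=.
- by exists 1 => //; exists 0; rewrite ?mulr0 ?subr0.
- move=> a b [s ns [k Kk h]] [s' ns' [k' Kk' h']].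
  exists (s * s'); first by move/qpr => [].
  exists (s' * k + s * k'); first by apply: KD; apply: KM.
  have -> : s * s' * (a + b) - (s' * k + s * k') = s' * (s * a - k) + s * (s' * b - k') by ring.
  by apply: MD; apply: MM.
- move=> r a [s ns [k Kk h]]; exists s => //; exists (r * k); first exact: KM.
  by have -> : s * (r * a) - r * k = r * (s * a - k) by [ring]; apply: MM.
Qed.

Lemma symb_dec n m : (n <= m)%N -> subp (symb m) (symb n).
Proof.
have stp k : subp (symb k.+1) (symb k).
  elim: k => // k IH x [s ns [c Kc h]]; exists s => //; exists c => //.
  by apply: h; [exact: ideal_mul_ideal|move=> a b qa /IH hb V _; apply].
move=> /subnK <-; elim: (m - n)%N => // k IH x; rewrite addSn => /stp; exact: IH.
Qed.

Lemma symb_ker n : subp K (symb n).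
Proof.
have [_ q1 _] := qprime; case: n => // n x Kx; exists 1 => //; exists x => //.
by rewrite mul1r subrr; case: (ideal_mul_ideal q (symb n)).
Qed.

Lemma symb_saturated n s x : ~ q s -> symb n (s * x) -> symb n x.
Proof.
have [_ _ qpr] := qprime; case: n => // n ns [s' ns' [k Kk h]].
exists (s' * s); first by move/qpr => [].
by exists k => //; rewrite -mulrA.
Qed.

Lemma symb_pow n a : q a -> symb n (a ^+ n).
Proof.
have [_ q1 _] := qprime; have [[K0 _ _] _ _] := Kprime.
move=> qa; elim: n => // n IH; exists 1 => //; exists 0 => //.
by rewrite mul1r subr0 exprS => V _; apply.
Qed.

(* Krull's argument: the symbolic powers of [q] become stationary modulo [y],
   hence (Nakayama at [Q]) stationary, hence (Nakayama at [q]) equal to [K]. *)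
Lemma krull_principal : subp q K.
Proof.
have [[K0 KD KM] K1 Kpr] := Kprime; have [[Q0 QD QM] Q1 Qpr] := Qprime.
have [[q0 qD qM] q1 qpr] := qprime.
pose J n x := exists2 v, symb n v & exists c, x - v = y * c.
have hJ n : is_ideal (J n).
  have [P0 PD PM] := symb_ideal n; split.
  - by exists 0 => //; exists 0; rewrite mulr0 subrr.
  - move=> a b [v hv [c hc]] [w hw [d hd]]; exists (v + w); first exact: PD.
    by exists (c + d); rewrite mulrDr -hc -hd; ring.
  - by move=> r a [v hv [c hc]]; exists (r * v); [exact: PM|exists (r * c); rewrite mulrCA -hc; ring].
pose I z := exists2 v, K v & exists c, z - v = y * c.
have hI : is_ideal I.
  split.
  - by exists 0 => //; exists 0; rewrite mulr0 subrr.
  - move=> a b [v hv [c hc]] [w hw [d hd]]; exists (v + w); first exact: KD.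
    by exists (c + d); rewrite mulrDr -hc -hd; ring.
  - by move=> r a [v hv [c hc]]; exists (r * v); [exact: KM|exists (r * c); rewrite mulrCA -hc; ring].
have [||||n hn] := local_dcc hI _ _ hJ.
- by move=> x Kx; exists x => //; exists 0; rewrite mulr0 subrr.
- by exists 0 => //; exists 1; rewrite subr0 mulr1.
- by move=> n m le x [v hv h]; exists v => //; apply: symb_dec hv.
- by move=> n x [v hv h]; exists v => //; apply: symb_ker.
have [g [gS Sg]] := acc_fg acc (symb_ideal n).
have [_ SD SM] := symb_ideal n.
(* Stationarity gives s x - z = y c. Since [y] is outside [q], the factor [c] is itself in [symb n],
   so the error y c lies in Q times [symb n]. *)
have step x : symb n x -> exists2 s, ~ Q s & exists2 z, symb n.+1 z &
    @pspan S S^o Q g (s * x - z).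
  move=> hx; have [||s nQs [z hz [c hc]]] := hn n.+1 _ x; first by lia.
    by exists x => //; exists 0; rewrite mulr0 subrr.
  exists s => //; exists z => //; rewrite hc.
  have gc : igen g c.
    apply: Sg.
    have hyc : symb n (y * c).
      rewrite -hc; have -> : s * x - z = s * x + (-1) * z by ring.
      by apply: SD; apply: SM => //; apply: symb_dec hz; lia.
    exact: symb_saturated nqy hyc.
  apply: (gc (fun c => @pspan S S^o Q g (y * c))).
    have [P0 PD PM] := @pspan_submod S S^o Q g.
    split; first by rewrite mulr0.
      by move=> a b ha hb; rewrite mulrDr; apply: PD.
    by move=> r a ha; rewrite -[r *: a]/(r * a) mulrCA; apply: PM.
  move=> r x0 _ hx0; rewrite -[r *: x0]/(r * x0) mulrA.
  by apply: (@pspan_scale S S^o) => //; rewrite mulrC; apply: QM.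
have [d nQd hd] : exists2 d, ~ Q d & forall x, x \in g -> symb n.+1 (d * x).
  apply: (@nakayama S S^o Q g (symb n.+1)) => //; first exact: symb_ideal.
  by move=> x /gS /step.
have gS1 x : x \in g -> symb n.+1 x.
  by move=> /hd; apply: symb_saturated => /qQ.
(* Locally at [q], [symb n] is now q times itself modulo [K], so Nakayama puts it inside [K]. It
   contains the n-th powers of the elements of [q], and [K] is prime. *)
have [e nqe he] : exists2 e, ~ q e & forall x, x \in g -> K (e * x).
  apply: (@nakayama S S^o q g K) => //.
  move=> x /gS1[s ns [k Kk h]]; exists s => //; exists k => //.
  apply: h; first exact: (@pspan_submod S S^o).
  move=> c z qc /Sg gz; apply: (gz (fun z => @pspan S S^o q g (c * z))).
    have [P0 PD PM] := @pspan_submod S S^o q g.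
    split; first by rewrite mulr0.
      by move=> a b ha hb; rewrite mulrDr; apply: PD.
    by move=> r a ha; rewrite -[r *: a]/(r * a) mulrCA; apply: PM.
  move=> r x0 _ hx0; rewrite -[r *: x0]/(r * x0) mulrA.
  by apply: (@pspan_scale S S^o) => //; rewrite mulrC; apply: qM.
have gK x : x \in g -> K x by move=> /he/Kpr[/Kq|].
move=> a qa; have : K (a ^+ n) by apply: (@igen_min S g) (Sg _ (symb_pow n qa)).
elim: n {hn hd he g gS Sg SD SM step d nQd gS1 e nqe gK} => [|n IH]; first by rewrite expr0.
by rewrite exprS => /Kpr[|/IH].
Qed.

End KrullPrincipal.

(** * Primes of polynomial rings *)

(** Catenarity bounds the chains that start at [K], so descending from any prime over K + (y) stops
    at a minimal one; Krull's theorem then leaves no prime strictly between. *)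
Lemma exists_adjacent_prime (S : comPzRingType) (K : S -> Prop) (y : S) :
    acc_seq S -> catenary S -> is_prime K -> ~ (exists2 k, K k & exists c, 1 = k + y * c) ->
    ~ K y ->
  exists Q, [/\ is_prime Q, subp K Q, Q y, ~ subp Q K &
    forall q, is_prime q -> subp K q -> subp q Q -> subp q K \/ subp Q q].
Proof.
move=> acc cat Kprime nunit nKy; have [[K0 KD KM] K1 Kpr] := Kprime.
pose I z := exists2 k, K k & exists c, z = k + y * c.
have hI : is_ideal I.
  split; first by exists 0 => //; exists 0; rewrite mulr0 addr0.
    move=> a b [k hk [c ->]] [l hl [d ->]]; exists (k + l); first exact: KD.
    by exists (c + d); ring.
  move=> r a [k hk [c ->]]; exists (r * k); first exact: KM.
  by exists (r * c); ring.
have KI : subp K I by move=> k Kk; exists k => //; exists 0; rewrite mulr0 addr0.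
have Iy : I y by exists 0 => //; exists 1; rewrite add0r mulr1.
have [Q0 [hQ0 IQ0]] := acc_prime acc hI nunit.
have KQ0 : subp K Q0 by move=> x /KI/IQ0.
have [k [nc _]] := cat K Q0 Kprime hQ0 KQ0.
suff [Q [hQ KQ Qy mn]] : exists Q, [/\ is_prime Q, subp K Q, Q y &
    forall P, is_prime P -> subp K P -> P y -> subp P Q -> subp Q P].
  exists Q; split=> //; first by move=> QK; apply: nKy; apply: QK.
  move=> q hq Kq qQ; have [qy|nqy] := classic (q y); first by right; apply: mn.
  by left; exact: (krull_principal acc Kprime hQ Qy mn hq Kq qQ nqy).
have Q0y := IQ0 _ Iy; move: k.+1 {IQ0} Q0 hQ0 KQ0 Q0y nc => n.
elim: n => [|n IH] Q hQ KQ Qy nc.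
  by case: nc; exists (fun _ => Q); split=> //; split.
have [[P [hP KP Py [PQ nQP]]]|h] := classic (exists P,
    [/\ is_prime P, subp K P, P y & subp P Q /\ ~ subp Q P]).
  apply: (IH P) => // hc; apply: nc; rewrite -addn1.
  exact: has_chain_len_cat hc (has_chain_len1 _ _ _ _).
exists Q; split=> // P hP KP Py PQ; apply: NNPP => nQP; apply: h.
by exists P.
Qed.

Section PolynomialRing.
Variable S : comNzRingType.
Implicit Types (K P Q : S -> Prop) (f g h : {poly S}).

(** Powers of the leading coefficient stand in for division in a fraction field. The bound on
    [size c] feeds the degree comparison in [poly_adjacent]. *)
Lemma pseudo_division h d n f : size h = d.+1 -> (size f <= n)%N ->
  exists N c r, [/\ (lead_coef h ^+ N) *: f = h * c + r, (size r <= d)%N & (size c <= n - d)%N].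
Proof.
move=> sh; elim: n f => [|n IH] f sf.
  exists 0%N, 0, f; rewrite expr0 scale1r mulr0 add0r size_poly0; split=> //; lia.
case: (ltnP d (size f)) => [lt|le]; last first.
  by exists 0%N, 0, f; rewrite expr0 scale1r mulr0 add0r size_poly0; split.
have ld : (d <= n)%N by lia.
pose f1 := lead_coef h *: f - h * (f`_n *: 'X^(n - d)).
have sf1 : (size f1 <= n)%N.
  apply/leq_sizeP => j; rewrite leq_eqVlt => /predU1P[<-|ltj].
    rewrite coefB coefZ -scalerAr coefZ coefMXn ltnNge leq_subr /= subKn //.
    by rewrite lead_coefE sh /= mulrC subrr.
  rewrite coefB coefZ (nth_default _ (_ : size f <= j)%N) ?mulr0 ?sub0r; last lia.
  rewrite -scalerAr coefZ coefMXn ifF; last by apply/negbTE; rewrite -leqNgt; lia.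
  by rewrite [h`_ _]nth_default ?mulr0 ?oppr0 // sh; lia.
have [N [c [r [e sr sc]]]] := IH f1 sf1.
exists N.+1, (c + lead_coef h ^+ N *: (f`_n *: 'X^(n - d))), r; split=> //.
  rewrite mulrDr addrAC -e /f1 exprSr -scalerA scalerBr -scalerAr.
  by rewrite -!scalerAr subrK.
rewrite (leq_trans (size_polyD _ _)) // geq_max (leq_trans sc) ?leq_sub2r //=.
rewrite (leq_trans (size_scale_leq _ _)) // (leq_trans (size_scale_leq _ _)) //.
by rewrite size_polyXn; lia.
Qed.

Definition polyp K f := forall i, K f`_i.

Definition contr (P : {poly S} -> Prop) (a : S) := P a%:P.

Lemma polyp_ideal K : is_ideal K -> is_ideal (polyp K).
Proof.
move=> [K0 KD KM]; split; first by move=> i; rewrite coef0.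
  by move=> f g hf hg i; rewrite coefD; apply: KD.
move=> r f hf i; rewrite coefM; apply: big_ind => // j _; exact: KM.
Qed.

(** Leading terms with coefficient in [K] are stripped off; the size of the representative obtained
    is the true size over S/K. *)
Lemma polyp_lead K f : is_ideal K -> ~ polyp K f ->
  exists g, [/\ ~ K (lead_coef g), (size g <= size f)%N & polyp K (f - g)].
Proof.
move=> hK; have [K0 KD KM] := hK; move: {2}(size f) (leqnn (size f)) => n.
elim: n f => [|n IH] f sf nf.
  by case: nf; move: sf; rewrite leqn0 size_poly_eq0 => /eqP-> i; rewrite coef0.
have [Kl|nKl] := classic (K (lead_coef f)); last first.
  by exists f; split=> //; rewrite subrr => i; rewrite coef0.
have nz : f != 0 by apply/eqP => f0; apply: nf; rewrite f0 => i; rewrite coef0.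
pose f1 := f - lead_coef f *: 'X^((size f).-1).
have sf1 : (size f1 < size f)%N.
  rewrite -(prednK (_ : 0 < size f)%N) ?size_poly_gt0 // ltnS; apply/leq_sizeP => j.
  rewrite leq_eqVlt coefB coefZ coefXn => /predU1P[<-|ltj].
    by rewrite eqxx mulr1 lead_coefE subrr.
  by rewrite gtn_eqF // mulr0 subr0 nth_default // (leq_trans (leqSpred _)).
 
have Kf1 : polyp K (f - f1).
  by move=> i; rewrite opprB addrC subrK coefZ mulrC; apply: KM.
have [_ PD _] := polyp_ideal hK.
have [||g [ng sg hg]] := IH f1; first by lia.
  by move=> h; apply: nf; rewrite -[f](subrK f1); apply: PD.
exists g; split=> //; first by lia.
by rewrite -[f](subrK f1) -addrA; apply: PD.
Qed.

Lemma polyp_prime K : is_prime K -> is_prime (polyp K).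
Proof.
move=> [hK K1 Kpr]; have hP := polyp_ideal hK; have [P0 PD PM] := hP.
have [K0 KD KM] := hK.
split=> //; first by move/(_ 0%N); rewrite coef1.
move=> f g hfg; apply: NNPP => /not_or_and[].
move=> /(polyp_lead hK)[f1 [nf1 _ hf1]] /(polyp_lead hK)[g1 [ng1 _ hg1]].
suff : polyp K (f1 * g1) by move/(_ (size f1 + size g1).-2); rewrite -mul_lead_coef => /Kpr[].
have -> : f1 * g1 = f * g + (- g1) * (f - f1) + (- f) * (g - g1) by ring.
by apply: (PD) (PM _ _ hg1); apply: (PD) (PM _ _ hf1).
Qed.

Lemma polyp_sub K (P : {poly S} -> Prop) : is_ideal P -> subp K (contr P) -> subp (polyp K) P.
Proof.
move=> [P0 PD PM] h f hf; rewrite -[f]coefK poly_def; apply: big_ind => // i _.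
by rewrite -mul_polyC mulrC; apply: PM; apply: h.
Qed.

Lemma polypC K a : is_ideal K -> polyp K a%:P <-> K a.
Proof.
move=> [K0 _ _]; split=> [/(_ 0%N)|Ka i]; first by rewrite coefC.
by rewrite coefC; case: ifP.
Qed.

Lemma contr_ideal (P : {poly S} -> Prop) : is_ideal P -> is_ideal (contr P).
Proof.
move=> [P0 PD PM]; rewrite /contr; split; first by rewrite polyC0.
  by move=> a b; rewrite polyCD; apply: PD.
by move=> r a; rewrite polyCM; apply: PM.
Qed.

Lemma contr_prime (P : {poly S} -> Prop) : is_prime P -> is_prime (contr P).
Proof.
by move=> [hP P1 Ppr]; split=> [|//|a b]; [exact: contr_ideal|rewrite /contr polyCM; apply: Ppr].
Qed.

Lemma polyp_chain K Q n : has_chain_len K Q n -> has_chain_len (polyp K) (polyp Q) n.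
Proof.
move=> [C [[CP CS] h]]; exists (fun i => polyp (C i)); split.
  split=> i ile; first by apply: polyp_prime; apply: CP.
  have [h1 h2] := CS i ile; split; first by move=> f hf j; apply: h1.
  have [hi _ _] := CP i (ltnW ile); have [hi1 _ _] := CP i.+1 ile.
  by move=> h3; apply: h2 => a /(polypC _ hi1)/h3/(polypC _ hi).
by move=> i ile; have [h1 h2] := h i ile; split=> f hf j; [apply: h1|apply: h2].
Qed.

(* Over the fraction field of [S / contr K'], this says that every nonzero prime of a
   polynomial ring in one variable is maximal. *)
Lemma poly_adjacent (K' q : {poly S} -> Prop) : is_prime K' -> is_prime q ->
  subp (polyp (contr K')) q -> subp q K' -> subp q (polyp (contr K')) \/ subp K' q.
Proof.
move=> K'prime qprime Kq qK'; pose K := contr K'.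
have Kprime := contr_prime K'prime; have [hK K1 Kpr] := Kprime.
have [hK' K'1 K'pr] := K'prime; have [[_ K'D K'M] hq] := (hK', qprime).
have [[q0 qD qM] q1 qpr] := qprime.
have [PKi PK1 PKpr] := polyp_prime Kprime.
have [qK|nqK] := classic (subp q (polyp K)); [by left|right].
(* An element of least degree modulo [K]: over the fraction field of S/K it generates the extension
   of [V]. *)
have minimal (V : {poly S} -> Prop) : is_ideal V -> subp (polyp K) V -> ~ subp V (polyp K) ->
  exists h, [/\ V h, ~ K (lead_coef h) & forall f, V f -> (size f < size h)%N -> polyp K f].
  move=> [V0 VD VM] KV nVK.
  have [f0 [Vf0 nf0]] : exists f, V f /\ ~ polyp K f.
    by apply: NNPP => h; apply: nVK => f Vf; apply: NNPP => nf; apply: h; exists f.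
  move: {2}(size f0) (leqnn (size f0)) => n; elim: n f0 Vf0 nf0 => [|n IH] f Vf nf sf.
    by case: nf; move: sf; rewrite leqn0 size_poly_eq0 => /eqP-> i; rewrite coef0; case: hK.
  have [[f1 [Vf1 sf1 nf1]]|h] := classic (exists f1, [/\ V f1, (size f1 < size f)%N & ~ polyp K f1]).
    by apply: (IH f1) => //; lia.
  have [g [ng sg hg]] := polyp_lead hK nf; exists g; split=> //.
    have -> : g = f + (-1) * (f - g) by ring.
    by apply: VD => //; apply: VM; apply: KV.
  move=> f1 Vf1 s1; apply: NNPP => nf1; apply: h; exists f1; split=> //; lia.
have [h [K'h nKh minh]] : exists h, [/\ K' h, ~ K (lead_coef h) &
    forall f, K' f -> (size f < size h)%N -> polyp K f].
  by apply: minimal => // [|h]; [move=> f /Kq/qK'|apply: nqK => f /qK'/h].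
have [g [qg nKg ming]] : exists h, [/\ q h, ~ K (lead_coef h) &
    forall f, q f -> (size f < size h)%N -> polyp K f] by apply: minimal => //; case: qprime.
have lc0 (f : {poly S}) : ~ K (lead_coef f) -> ~ polyp K f by move=> n1 /(_ (size f).-1).
have nKhN N f : K' f -> ~ polyp K f -> ~ polyp K (lead_coef h ^+ N *: f).
  move=> _ nf; rewrite -mul_polyC => /PKpr[|//]; rewrite polypC // => hN; apply: nKh.
  by elim: N hN => [|N IH]; rewrite ?expr0 // exprS => /Kpr[|/IH].
case sh: (size h) => [|d].
  by case: nKh; move/eqP: sh; rewrite size_poly_eq0 => /eqP->; rewrite lead_coef0; case: hK.
have div f : K' f -> exists N c r, [/\ (lead_coef h ^+ N) *: f = h * c + r, polyp K r &
    (size c <= size f - d)%N].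
  move=> K'f; have [N [c [r [e sr sc]]]] := pseudo_division sh (leqnn (size f)).
  exists N, c, r; split=> //; apply: minh; last by rewrite sh.
  have -> : r = (lead_coef h ^+ N)%:P * f + (- c) * h by rewrite mul_polyC e; ring.
  by apply: K'D; apply: K'M.
have d0 : (0 < d)%N.
  case: d sh {div} => // sh; case: nKh; have := K'h.
  by rewrite [h]size1_polyC ?sh // lead_coefC.
(* Dividing [g] by [h] puts h c in [q]. If [c] were in [q], then, having smaller degree than [g]
   because [h] is not constant, it would lie in K[X], and so would [g]. *)
have qh : q h.
  have [N [c [r [e hr sc]]]] := div g (qK' _ qg).
  have : q (h * c).
    have -> : h * c = (lead_coef h ^+ N)%:P * g + (- 1) * r by rewrite mul_polyC e; ring.
    by apply: qD; apply: qM => //; apply: Kq.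
  move=> /qpr[//|qc]; have g0 : (0 < size g)%N.
    by rewrite size_poly_gt0; apply/eqP => g0; apply: nKg; rewrite g0 lead_coef0; case: hK.
  case: (nKhN N g); [exact: qK'|exact: lc0|]; rewrite e.
  have [_ PD PM] := PKi; apply: PD => //; apply: PM.
  by apply: ming => //; lia.
move=> f K'f; have [N [c [r [e hr sc]]]] := div f K'f.
have : q ((lead_coef h ^+ N)%:P * f).
  by rewrite mul_polyC e mulrC; apply: qD; [apply: qM|apply: Kq].
move=> /qpr[qN|//]; exfalso; apply: nKh; move/qK': qN {e}.
by elim: N => [|N IH]; rewrite ?expr0 // exprS polyCM => /K'pr[|/IH].
Qed.

(** By [poly_adjacent], [K'] has relative height at most one over the extension of its contraction,
    and relative heights add up in a catenary ring. *)
Lemma algebraic_chain_len (K' Q' : {poly S} -> Prop) f n : catenary {poly S} ->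
    is_prime K' -> is_prime Q' -> subp K' Q' -> K' f -> ~ polyp (contr K') f ->
  has_chain_len (polyp (contr K')) Q' n.+1 -> has_chain_len K' Q' n.
Proof.
move=> cat K'prime Q'prime KQ K'f nf hc.
have Kpr := polyp_prime (contr_prime K'prime).
have KK' : subp (polyp (contr K')) K' by apply: polyp_sub => //; case: K'prime.
have [k [m [lk lm lkm]]] := catenary_chain_length cat Kpr K'prime Q'prime KK' KQ.
have le := chain_length_max lkm hc.
have k2 : (k < 2)%N.
  rewrite ltnNge; apply/negP => k2; case: (lk) => h _.
  apply: (adjacent_chain_len _ (has_chain_len_le k2 h)) => q hq.
  exact: poly_adjacent.
by case: lm => h _; apply: has_chain_len_le h; lia.
Qed.

(** From an ideal that is not finitely generated, repeatedly choose an element of least degree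
    outside what is generated so far. Some leading coefficient lies in the ideal of the earlier
    ones, and cancelling it yields a smaller element that is still outside. *)
Lemma hilbert_basis : acc_seq S -> acc_seq {poly S}.
Proof.
move=> acc; apply/noetherian_acc/acc_noetherian => I hI; apply: NNPP => nfg.
have [I0 ID IM] := hI.
have ex (s : seq {poly S}) : exists f, (forall x, x \in s -> I x) ->
    [/\ I f, ~ igen s f & forall g, I g -> (size g < size f)%N -> igen s g].
  apply: NNPP => h; apply: nfg; exists s.
  have sI : forall x, x \in s -> I x by apply: NNPP => nsI; apply: h; exists 0.
  split=> // f If; apply: NNPP => nf; move: {2}(size f) (leqnn (size f)) => n.
  elim: n f If nf => [|n IH] f If nf sf.
    by case: nf; move: sf; rewrite leqn0 size_poly_eq0 => /eqP->; case: (igen_ideal s).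
  apply: h; exists f => _; split=> // g Ig sg; apply: NNPP => ng.
  by apply: (IH g) => //; lia.
pose F s := sval (constructive_indefinite_description _ (ex s)).
have FP s : (forall x, x \in s -> I x) ->
    [/\ I (F s), ~ igen s (F s) & forall g, I g -> (size g < size (F s))%N -> igen s g].
  exact: svalP (constructive_indefinite_description _ (ex s)).
pose G n := iter n (fun s => rcons s (F s)) [::].
have GI n : forall x, x \in G n -> I x.
  elim: n => //= n IH x; rewrite mem_rcons inE => /predU1P[->|]; last exact: IH.
  by have [] := FP (G n) IH.
have Gs m n : (m <= n)%N -> {subset G m <= G n}.
  move=> /subnK <-; elim: (n - m)%N => // k IH x /IH h.
  by rewrite addSn /= mem_rcons inE h orbT.
have [m hm] := acc (fun n => lead_coef (F (G n))).
have [IF nF minF] := FP (G m) (GI m).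
pose d := size (F (G m)).
pose L a := exists f, [/\ igen (G m) f, (size f <= d)%N & f`_d.-1 = a].
have hL : is_ideal L.
  have [J0 JD JM] := igen_ideal (G m); split.
  - by exists 0; rewrite size_poly0 coef0.
  - move=> a b [f [hf sf <-]] [g [hg sg <-]]; exists (f + g); rewrite coefD; split=> //.
      exact: JD.
    by rewrite (leq_trans (size_polyD _ _)) // geq_max sf sg.
  - move=> r a [f [hf sf <-]]; exists (r%:P * f); rewrite coefCM; split=> //.
      exact: JM.
    by rewrite mul_polyC (leq_trans (size_scale_leq _ _)).
have [f [hf sf ef]] : L (lead_coef (F (G m))).
  apply: (@igen_min _ _ L hL) hm => x /mapP[i]; rewrite mem_iota add0n => /andP[_ lt] ->.
  have [IFi nFi minFi] := FP (G i) (GI i).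
  (* Minimality of the earlier choice bounds its degree, so a power of ['X] can raise it to the
     degree of the later one. *)
  have le : (size (F (G i)) <= d)%N.
    rewrite leqNgt; apply/negP => lt'; apply: nF.
    exact: (igen_subset (Gs _ _ (ltnW lt)) (minFi _ IF lt')).
  have Fi0 : (0 < size (F (G i)))%N.
    by rewrite size_poly_gt0; apply/eqP => F0; apply: nFi; rewrite F0; case: (igen_ideal (G i)).
  exists ('X^(d - size (F (G i))) * F (G i)); split.
  - have [_ _ JM] := igen_ideal (G m); apply: JM.
    apply: igen_mem; apply: (Gs i.+1 m lt).
    by rewrite /= mem_rcons mem_head.
  - by rewrite (leq_trans (size_polyMleq _ _)) // size_polyXn; lia.
  - rewrite coefXnM ifF; last by apply/negbTE; rewrite -leqNgt; lia.
    by rewrite lead_coefE; congr (_`_ _); lia.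
have d0 : (0 < d)%N.
  by rewrite size_poly_gt0; apply/eqP => F0; apply: nF; rewrite F0; case: (igen_ideal (G m)).
have [_ JD JM] := igen_ideal (G m).
apply: nF; rewrite -[F _](subrK f); apply: JD => //; apply: minF.
  have -> : F (G m) - f = F (G m) + (-1) * f by ring.
  apply: ID => //; apply: IM; exact: (@igen_min _ (G m) I hI (GI m)).
rewrite -/d -(prednK d0) ltnS; apply/leq_sizeP => j.
rewrite leq_eqVlt coefB => /predU1P[<-|ltj]; first by rewrite ef subrr.
have dj : (d <= j)%N by rewrite -(prednK d0).
by rewrite !nth_default ?subrr // (leq_trans sf).
Qed.

Lemma fg_algebra_poly (R : comPzRingType) (phi : {rmorphism R -> S}) :
  fg_algebra phi -> exists psi : {rmorphism R -> {poly S}}, fg_algebra psi.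
Proof.
move=> [n [s hs]]; exists (polyC \o phi).
exists n.+1, (fun i => if unlift ord0 i is Some j then (s j)%:P else 'X).
move=> f P Pphi Ps PD PM.
have PX : P 'X by have := Ps ord0; rewrite unlift_none.
have PC a : P a%:P.
  apply: (hs a (fun a => P a%:P)) => [r|i|x z hx hz|x z hx hz].
  - exact: Pphi.
  - by have := Ps (lift ord0 i); rewrite liftK.
  - by rewrite polyCD; apply: PD.
  - by rewrite polyCM; apply: PM.
by elim/poly_ind: f => [|f c IH]; [rewrite -polyC0|apply: PD => //; apply: PM].
Qed.

End PolynomialRing.

(** * Adjoining linear forms *)

(* The form is built one generator at a time as the graph [G] of a partial map on [N];
   when a multiple [a *: g] of the new generator is already in its domain, rescaling by [a]
   keeps the values in [A]. *)
Lemma separating_linear_form (A : idomainType) (N : lmodType A) (gens W : seq N) (y : N) :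
    (forall x, span gens x) -> (forall a, a != 0 -> ~ span W (a *: y)) ->
  exists h : N -> A, [/\ lin_form h, (forall w, w \in W -> h w = 0) & h y != 0].
Proof.
move=> gen_all indep.
have [G [[GD GZ G0] [GW [c0 c0n0 Gy] Ggens]]] : exists G : N -> A -> Prop,
    [/\ (forall x a z b, G x a -> G z b -> G (x + z) (a + b)),
        (forall r x a, G x a -> G (r *: x) (r * a)) & forall a, G 0 a -> a = 0] /\
    [/\ (forall w, w \in W -> G w 0), (exists2 c, c != 0 & G y c) &
        forall g, g \in gens -> exists a, G g a].
  elim: {gen_all} gens => [|g gens [G [[GD GZ G0] [GW [c0 c0n0 Gy] Ggens]]]].
    have [S0 SD SZ] := pspan_submod (fun _ => True) W.
    (* The initial domain is spanned by [W] and [y], with [W] sent to 0 and [y] to 1; [indep] makes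
       this well defined. *)
    exists (fun x a => span W (x - a *: y)); split; split=> //.
    - by move=> x a z b h1 h2; rewrite scalerDl opprD addrACA; apply: SD.
    - by move=> r x a h; rewrite -scalerA -scalerBr; apply: SZ.
    - move=> a; rewrite sub0r -scaleNr => h; apply/eqP; rewrite -oppr_eq0.
      by apply/negPn/negP => /indep.
    - by move=> w Ww; rewrite scale0r subr0; apply: span_mem.
    - by exists 1; rewrite ?oner_neq0 // scale1r subrr.
  have G00 : G 0 0 by have := GZ 0 _ _ Gy; rewrite scale0r mul0r.
  have [[a [a0 [d Gad]]]|nG] := classic (exists a, a != 0 /\ exists d, G (a *: g) d).
    exists (fun x c => exists v e r, [/\ G v e, x = v + r *: g & c = a * e + r * d]).
    split; split.
    - move=> x c z c' [v [e [r [hv -> ->]]]] [v' [e' [r' [hv' -> ->]]]].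
      exists (v + v'), (e + e'), (r + r'); split; first exact: GD.
        by rewrite scalerDl addrACA.
      by ring.
    - move=> s x c [v [e [r [hv -> ->]]]]; exists (s *: v), (s * e), (s * r); split.
      + exact: GZ.
      + by rewrite scalerDr scalerA.
      + by ring.
    - move=> c [v [e [r [hv e0 ->]]]]; apply: G0.
      have -> : 0 = a *: v + r *: (a *: g) by rewrite scalerA [r * a]mulrC -scalerA -scalerDr -e0 scaler0.
      by apply: GD; apply: GZ.
    - by move=> w Ww; exists w, 0, 0; split; [exact: GW|rewrite scale0r addr0|rewrite mulr0 mul0r addr0].
    - exists (a * c0); first by rewrite mulf_neq0.
      by exists y, c0, 0; split; rewrite ?scale0r ?mul0r ?addr0.
    - move=> x; rewrite inE => /predU1P[->|/Ggens[e hx]].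
        by exists d, 0, 0, 1; split; rewrite ?scale1r ?mulr0 ?mul1r ?add0r.
      by exists (a * e), x, e, 0; split; rewrite ?scale0r ?mul0r ?addr0.
  (* No nonzero multiple of [g] lies in the domain, so [g] may be sent to 0. *)
  exists (fun x c => exists r, G (x - r *: g) c); split; split.
  - move=> x c z c' [r hr] [r' hr']; exists (r + r').
    by rewrite scalerDl opprD addrACA; apply: GD.
  - by move=> s x c [r hr]; exists (s * r); rewrite -scalerA -scalerBr; apply: GZ.
  - move=> c [r hr]; have r0 : r = 0.
      apply/eqP/negPn/negP => r0; apply: nG; exists (- r); rewrite oppr_eq0; split=> //.
      by exists c; rewrite scaleNr -sub0r.
    by apply: G0; move: hr; rewrite r0 scale0r subr0.
  - by move=> w Ww; exists 0; rewrite scale0r subr0; apply: GW.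
  - by exists c0 => //; exists 0; rewrite scale0r subr0.
  - move=> x; rewrite inE => /predU1P[->|/Ggens[e hx]].
      by exists 0, 1; rewrite scale1r subrr.
    by exists e, 0; rewrite scale0r subr0.
have Gtot x : exists a, G x a.
  apply: (gen_all x (fun x => exists a, G x a)).
    split; first by exists 0; have := GZ 0 _ _ Gy; rewrite scale0r mul0r.
      by move=> x1 x2 [a ha] [b hb]; exists (a + b); apply: GD.
    by move=> r x1 [a ha]; exists (r * a); apply: GZ.
  by move=> r x1 _ /Ggens[a ha]; exists (r * a); apply: GZ.
pose h x := sval (constructive_indefinite_description _ (Gtot x)).
have hP x : G x (h x) := svalP (constructive_indefinite_description _ (Gtot x)).
have Guniq x a b : G x a -> G x b -> a = b.
  move=> ha hb; apply/eqP; rewrite -subr_eq0; apply/eqP/G0.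
  by have := GD _ _ _ _ ha (GZ (-1) _ _ hb); rewrite scaleN1r subrr mulN1r.
exists h; split.
- by move=> a x z; apply: (Guniq (a *: x + z)) => //; apply: GD => //; apply: GZ.
- by move=> w /GW; apply: Guniq.
- by rewrite (Guniq _ _ _ (hP y) Gy).
Qed.

Lemma mul_expf_inv (F : fieldType) (b z : F) i k : b != 0 ->
  b * (b ^+ i * b ^+ k) * (b^-1 * (z * b^-1 ^+ k)) = z * b ^+ i.
Proof.
move=> b0; have := expf_neq0 k b0; rewrite exprVn; set B := b ^+ k => B0.
by field; apply/andP.
Qed.

Lemma ker_prime (S : comPzRingType) (D : idomainType) (g : {rmorphism S -> D}) :
  is_prime (fun z => g z = 0).
Proof.
split; [split|by rewrite rmorph1 => /eqP; rewrite oner_eq0|].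
- by rewrite rmorph0.
- by move=> x z hx hz; rewrite rmorphD hx hz addr0.
- by move=> r x hx; rewrite rmorphM hx mulr0.
- by move=> x z /eqP; rewrite rmorphM mulf_eq0 => /orP[]/eqP; [left|right].
Qed.

Section LinearForms.
Variables (A : idomainType) (n : nat).
Local Notation T := {mpoly A[n]}.

Definition pairing (c v : 'I_n -> A) := \sum_(i < n) c i * v i.

(** Translation along [c] by a free parameter ['X]. Since the parameter is a variable, the argument
    works in every characteristic and over finite rings. *)
Definition shift (c : 'I_n -> A) : T -> {poly T} :=
  mmap (polyC \o @mpolyC n A) (fun i => ('X_i)%:P + (c i)%:MP%:P * 'X).

HB.instance Definition _ c := GRing.RMorphism.copy (shift c)
  (mmap (polyC \o @mpolyC n A) (fun i => ('X_i)%:P + (c i)%:MP%:P * 'X)).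

Lemma shiftC c a : shift c a%:MP = a%:MP%:P.
Proof. exact: mmapC. Qed.

Lemma shift_lform c v : shift c (lform v) = (lform v)%:P + (pairing c v)%:MP%:P * 'X.
Proof.
rewrite /lform /pairing !rmorph_sum mulr_suml -big_split /=; apply: eq_bigr => i _.
rewrite -mul_mpolyC rmorphM /= shiftC /shift mmapX mmap1U.
by rewrite mulrDr -polyCM mpolyCM polyCM; ring.
Qed.

(* If [x] is moved by a translation fixing the coefficients of [g], substituting
   [x + c 'X] for [x] shows that [x] cannot be a root of [g]. *)
Lemma shift_transcendental c v (g : {poly T}) : pairing c v != 0 ->
  (forall i, shift c g`_i = (g`_i)%:P) -> g.[lform v] = 0 -> g = 0.
Proof.
move=> cv0 hg g0; apply/eqP; rewrite -(@comp_poly2_eq0 _ g (shift c (lform v))); last first.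
  by rewrite shift_lform addrC size_MXaddC polyC_eq0 mpolyC_eq0 (negPf cv0) size_polyC mpolyC_eq0 cv0.
have := congr1 (shift c) g0; rewrite rmorph0 => <-.
rewrite /comp_poly !horner_coef size_map_polyC.
by apply/eqP; rewrite [RHS]rmorph_sum; apply: eq_bigr => i _; rewrite coef_map /= rmorphM rmorphXn /= hg.
Qed.

End LinearForms.

Section AdjoinGenerators.
Variables (R : comPzRingType) (A : idomainType) (N : lmodType A).
Variables (gens : seq N) (n : nat) (f : N -> 'I_n -> A) (y : N).
Local Notation T := {mpoly A[n]}.
Variable C : T -> Prop.
Hypothesis ucat : universally_catenary R.
Hypothesis gen_all : forall x, span gens x.
Hypothesis femb : rees_embedding f.
Hypotheses (CC : forall a, C a%:MP) (CD : forall x z, C x -> C z -> C (x + z)).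
Hypothesis CM : forall x z, C x -> C z -> C (x * z).
Hypothesis y_not_integral : ~ integral_over_sub C (lform (f y)).
Local Notation ell x := (lform (f x)).

Lemma lform_linear a x z : ell (a *: x + z) = a *: ell x + ell z :> T.
Proof.
rewrite /lform scaler_sumr -big_split /=; apply: eq_bigr => i _.
by have [/(_ i) fl _] := femb; rewrite fl scalerA scalerDl.
Qed.

Lemma lform0 : ell 0 = 0 :> T.
Proof.
by have := lform_linear (-1) 0 0; rewrite scaler0 addr0 scaleN1r addNr.
Qed.

Lemma lformZ a x : ell (a *: x) = a%:MP * ell x :> T.
Proof. by rewrite -[a *: x]addr0 lform_linear lform0 addr0 mul_mpolyC. Qed.

Lemma y_neq0 : ell y != 0 :> T.
Proof.
apply/eqP => e0; apply: y_not_integral; exists 1%N, (fun _ => 0).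
by split=> [_|]; [have := CC 0; rewrite mpolyC0|rewrite e0 big_ord1 mul0r addr0 expr1].
Qed.

(* The domain [A[W]] is encoded by the kernel of [ev : S -> T]; the last clause says that
   the translations of the variables killing [W] fix it. *)
Record adjoined (S : comNzRingType) (iota : {rmorphism A -> S}) (ev : {rmorphism S -> T})
    (W : seq N) : Prop := Adjoined {
  adjoined_acc : acc_seq S;
  adjoined_fg : exists phi : {rmorphism R -> S}, fg_algebra phi;
  adjoined_iota : forall a, ev (iota a) = a%:MP;
  adjoined_C : forall z, C (ev z);
  adjoined_mem : forall w, w \in W -> exists z, ev z = ell w;
  adjoined_shift : forall c, (forall w, w \in W -> pairing c (f w) = 0) ->
    forall z, shift c (ev z) = (ev z)%:P }.

Lemma adjoined_span S iota ev W x : @adjoined S iota ev W -> span W x -> exists z, ev z = ell x.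
Proof.
move=> adj; apply: (@span_min _ _ W (fun x => exists z, ev z = ell x)); last exact: adjoined_mem adj.
split; first by exists 0; rewrite rmorph0 lform0.
  move=> x1 x2 [z1 e1] [z2 e2]; exists (z1 + z2).
  by rewrite rmorphD e1 e2 -[x1]scale1r lform_linear !scale1r.
move=> r x1 [z1 e1]; exists (iota r * z1).
by rewrite rmorphM e1 (adjoined_iota adj) lformZ.
Qed.

Lemma adjoin S iota ev W u : @adjoined S iota ev W -> C (ell u) ->
  exists ev' : {rmorphism {poly S} -> T},
    [/\ @adjoined {poly S} (polyC \o iota) ev' (u :: W),
        (forall z, ev' z%:P = ev z) & forall g, ev' g = (map_poly ev g).[ell u]].
Proof.
move=> adj Cu; have cfu : commr_rmorph ev (ell u) by move=> z; apply: mulrC.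
exists (horner_morph cfu); split=> //; last by move=> z; apply: horner_morphC.
split.
- exact: hilbert_basis (adjoined_acc adj).
- by have [phi /fg_algebra_poly] := adjoined_fg adj.
- by move=> a; rewrite /= horner_morphC (adjoined_iota adj).
- elim/poly_ind => [|g a IH]; first by rewrite rmorph0 -mpolyC0.
  rewrite rmorphD rmorphM /= horner_morphC horner_morphX.
  by apply: CD; [apply: CM|apply: adjoined_C adj _].
- move=> w; rewrite inE => /predU1P[->|/(adjoined_mem adj)[z e]].
    by exists 'X; apply: horner_morphX.
  by exists z%:P; rewrite /= horner_morphC.
- move=> c hc; elim/poly_ind => [|g a IH]; first by rewrite !rmorph0.
  have cu := hc u (mem_head _ _).
  rewrite rmorphD rmorphM /= horner_morphC horner_morphX rmorphD rmorphM /= IH shift_lform cu.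
  rewrite mpolyC0 mul0r addr0 (adjoined_shift adj) ?rmorphD ?rmorphM // => w Ww.
  by apply: hc; rewrite inE Ww orbT.
Qed.

Lemma adjoin_inverse S iota ev W : @adjoined S iota ev W ->
    (exists2 a, a != 0 & span W (a *: y)) ->
  exists P, [/\ is_prime P, subp (fun z => ev z = 0) P,
    ~ has_chain_len (fun z => ev z = 0) P 2 & forall a, span W (a *: y) -> P (iota a)].
Proof.
move=> adj [a0 a0n0 Wy]; pose b : {fraction T} := tofrac (ell y).
have b0 : b != 0 by rewrite tofrac_eq0 y_neq0.
have cfu : commr_rmorph (@tofrac T \o ev) b^-1 by move=> z; apply: mulrC.
pose E : {rmorphism {poly S} -> {fraction T}} := horner_morph cfu.
have EC z : E z%:P = tofrac (ev z) by apply: horner_morphC.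
have EX : E 'X = b^-1 by apply: horner_morphX.
pose K' g := E g = 0; have K'prime : is_prime K' by apply: ker_prime.
have cK' : peq (contr K') (fun z => ev z = 0).
  move=> z; rewrite /contr /K' EC; split=> [/eqP|->]; last exact: tofrac0.
  by rewrite tofrac_eq0 => /eqP.
have [phi fgphi] := adjoined_fg adj; have [psi fgpsi] := fg_algebra_poly fgphi.
have cat := ucat fgpsi.
(* The relation (a b) b^-1 = a serves twice: it makes 1/b algebraic, and it forces [a] into every
   prime containing [K'] and ['X]. *)
have rel a : span W (a *: y) -> exists2 z, ev z = a%:MP * ell y & K' (z%:P * 'X - (iota a)%:P).
  move=> /(adjoined_span adj)[z]; rewrite lformZ => e; exists z => //.
  by rewrite /K' rmorphB rmorphM /= !EC EX e (adjoined_iota adj) rmorphM /= mulfK ?subrr.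
have nunit : ~ (exists2 k, K' k & exists c, 1 = k + 'X * c).
  move=> [k K'k [c /(congr1 E)]]; rewrite rmorph1 rmorphD rmorphM /= K'k add0r EX => e1.
  (* Multiplying 1 = b^-1 c(b^-1) by b^(size c) gives an integral equation for b whose coefficients
     are those of [c], reversed and negated. *)
  apply: y_not_integral; exists (size c), (fun i => - ev c`_((size c).-1 - i)); split.
    by move=> i; rewrite -mulN1r; apply: CM; [rewrite -mpolyC1 -mpolyCN|apply: adjoined_C adj _].
  apply/eqP; rewrite -(@tofrac_eq0 T); apply/eqP.
  rewrite rmorphD rmorphXn /= -/b rmorph_sum /=.
  have -> : b ^+ size c = b ^+ (size c) * (b^-1 * E c) by rewrite -e1 mulr1.
  have -> : E c = \sum_(i < size c) tofrac (ev c`_i) * b^-1 ^+ i.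
    by rewrite /E /= /horner_morph /map_poly horner_poly.
  rewrite !mulr_sumr (reindex_inj rev_ord_inj) -big_split big1 //= => i _.
  rewrite rmorphM rmorphN rmorphXn /= -/b.
  have -> : ((size c).-1 - i = size c - i.+1)%N by lia.
  have -> : b ^+ size c = b * (b ^+ i * b ^+ (size c - i.+1)).
    by rewrite -exprD -exprS -addSn subnKC.
  by rewrite (mul_expf_inv _ _ _ b0) mulNr subrr.
have nKX : ~ K' 'X by rewrite /K' EX => /eqP; rewrite invr_eq0 (negPf b0).
have [Q [Qprime KQ QX nQK adjQ]] :=
  exists_adjacent_prime (hilbert_basis (adjoined_acc adj)) cat K'prime nunit nKX.
have [[Q0 QD QM] Q1 Qpr] := Qprime.
exists (contr Q); split.
- exact: contr_prime.
- by move=> z /cK' /KQ.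
- move=> hc; apply: (adjacent_chain_len adjQ).
  have [z ez K'z] := rel a0 Wy.
  apply: (algebraic_chain_len cat K'prime Qprime KQ K'z).
    move/(_ 1%N); rewrite coefB coefMX !coefC /= subr0 => /cK'/eqP.
    by rewrite ez mulf_eq0 mpolyC_eq0 (negPf a0n0) (negPf y_neq0).
  (* ['X] lies in [Q] but not in the extension of [contr Q], so the lifted chain gains one step.
     This makes up for the step lost in passing to [K']. *)
  rewrite -(addn1 2); apply: has_chain_len_cat (_ : has_chain_len (polyp (contr Q)) Q 1).
    by apply: has_chain_len_mono (polyp_chain hc) => // g hg i; apply/cK'.
  have hQ := contr_prime Qprime.
  apply: has_chain_len1 => //; first exact: polyp_prime.
    by apply: polyp_sub => //; case: Qprime.
  by move=> /(_ _ QX)/(_ 1%N); rewrite coefX /contr.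
- move=> a /rel[z _ /KQ Kz]; rewrite /contr.
  have -> : (iota a)%:P = z%:P * 'X + (-1) * (z%:P * 'X - (iota a)%:P) by ring.
  by apply: QD; apply: QM.
Qed.

(** [W] has already been adjoined and [l] is still to come; [v] collects the transcendental members
    of [l] and [c] counts the algebraic ones. The height bound is c + 1, the 1 coming from the
    height-one prime of [adjoin_inverse]. *)
Lemma adjoin_all l W S iota ev : @adjoined S iota ev W -> (forall u, u \in l -> C (ell u)) ->
    (exists2 a, a != 0 & span (l ++ W) (a *: y)) ->
  exists c v P, [/\ is_prime P, subp (fun z => ev z = 0) P,
      ~ has_chain_len (fun z => ev z = 0) P c.+2,
      forall a, span (l ++ W) (a *: y) -> P (iota a) &
    (size v + c = size l)%N /\
      forall u, u \in l -> exists2 a, a != 0 & span (v ++ W) (a *: u)].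
Proof.
elim: l W S iota ev => [|u l IH] W S iota ev adj Cl hy.
  have [P [h1 h2 h3 h4]] := adjoin_inverse adj hy.
  by exists 0%N, [::], P; split.
have [|ev' [adj' evC evE]] := adjoin (u := u) adj; first by apply: Cl; rewrite mem_head.
have perm : {subset u :: l ++ W <= l ++ u :: W}.
  by move=> x; rewrite !(inE, mem_cat) orbCA.
have [||c [v [P' [P'prime kerP' nch colP' [sv hv]]]]] := IH (u :: W) _ _ _ adj'.
- by move=> x lx; apply: Cl; rewrite inE lx orbT.
- by have [a a0 ha] := hy; exists a => //; apply: span_subset perm _ ha.
have KP : subp (fun z => ev z = 0) (contr P').
  by move=> z z0; apply: kerP'; rewrite evC.
have Pcol a : span ((u :: l) ++ W) (a *: y) -> contr P' (iota a).
  by move=> ha; apply: colP'; apply: span_subset perm _ ha.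
have K'prime : is_prime (fun g => ev' g = 0) by apply: ker_prime.
have cK' : peq (contr (fun g => ev' g = 0)) (fun z => ev z = 0).
  by move=> z; rewrite /contr evC.
have lift n0 : has_chain_len (fun z => ev z = 0) (contr P') n0 ->
    has_chain_len (polyp (contr (fun g => ev' g = 0))) P' n0.
  move=> /polyp_chain; apply: has_chain_len_mono; first by move=> g hg i; apply/cK'.
  by apply: polyp_sub => //; case: P'prime.
have [[a a0 ha]|indep] := classic (exists2 a, a != 0 & span W (a *: u)).
  (* Algebraic generator: as [a *: u] is in the span of [W], the kernel of [ev'] contains a
     polynomial a X - z with a nonzero. *)
  exists c.+1, v, (contr P'); split=> //; first exact: contr_prime.
    move=> /lift hc; apply: nch.
    have [z ez] := adjoined_span adj ha.
    have [phi /fg_algebra_poly[psi /ucat cat]] := adjoined_fg adj.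
    apply: (algebraic_chain_len cat K'prime P'prime kerP' (f := (iota a)%:P * 'X - z%:P)) hc.
      rewrite rmorphB rmorphM /= evE map_polyC /= hornerC evC (evE 'X) map_polyX hornerX.
      by rewrite (adjoined_iota adj) ez lformZ subrr.
    move/(_ 1%N); rewrite coefB coefMX !coefC /= subr0 => /cK'/eqP.
    by rewrite (adjoined_iota adj) mpolyC_eq0 (negPf a0).
  split; first by rewrite addnS sv.
  have sub : {subset W <= v ++ W} by move=> x; rewrite mem_cat orbC => ->.
  move=> x; rewrite inE => /predU1P[->|/hv[a' a'0 ha']].
    by exists a => //; apply: span_subset sub _ ha.
  exists (a * a'); first by rewrite mulf_neq0.
  (* The extra factor [a] moves every occurrence of [u] into the span of [W]. *)
  rewrite -scalerA; move: (a' *: x) ha' => w.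
  have [V0 VD VZ] := pspan_submod (fun _ => True) (v ++ W).
  apply: (@span_min _ _ _ (fun w => span (v ++ W) (a *: w))).
    split; first by rewrite scaler0.
      by move=> x1 x2 h1 h2; rewrite scalerDr; apply: VD.
    by move=> r x1 h1; rewrite scalerA mulrC -scalerA; apply: VZ.
  move=> x1; rewrite mem_cat inE orbCA => /predU1P[->|h1].
    exact: span_subset sub _ ha.
  by apply: VZ; apply: span_mem; rewrite mem_cat.
(* Transcendental generator: the kernel of [ev'] is contained in the extension of the kernel of
   [ev], so lifted chains keep their length. *)
exists c, (u :: v), (contr P'); split=> //; first exact: contr_prime.
  move=> /lift hc; apply: nch; apply: has_chain_len_mono hc => // g g0 i.
  apply/cK'; suff: map_poly ev g = 0 by move/(congr1 (fun g : {poly _} => g`_i)); rewrite coef_map coef0.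
  have [h [lin hW hu]] := @separating_linear_form A N gens W u gen_all
    (fun a a0 ha => indep (ex_intro2 _ _ a a0 ha)).
  have [_ /(_ h lin)[cc hcc]] := femb.
  apply: (@shift_transcendental _ _ cc (f u)); rewrite /pairing -?hcc -?evE //.
  move=> j; rewrite coef_map /= (adjoined_shift adj) // => w Ww.
  by rewrite /pairing -hcc hW.
split; first by rewrite /= addSn sv.
have perm' : {subset v ++ u :: W <= (u :: v) ++ W}.
  by move=> x; rewrite !(inE, mem_cat) orbCA orbA.
move=> x; rewrite inE => /predU1P[->|/hv[a a0 ha]].
  by exists 1; rewrite ?oner_neq0 // scale1r; apply: span_mem; rewrite mem_head.
by exists a => //; apply: span_subset perm' _ ha.
Qed.

End AdjoinGenerators.

(** * Passage to the domain R/Q *)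

(** The equality of structures lets modules over [A] be carried along by case analysis; classical
    choice supplies the inverses that [idomainType] demands. *)
Lemma idomain_structure (A : comNzRingType) :
    (forall x z : A, x * z = 0 -> x = 0 \/ z = 0) ->
  exists D : idomainType, (D : comNzRingType) = A.
Proof.
(* Destructing [A] makes the structure rebuilt below convertible to it. *)
case: A => A [? ? ? ? ? ? ? ? ? ? ? ?]; set B := GRing.ComNzRing.Pack _ => dom.
pose dec (x : B) := excluded_middle_informative (exists z, z * x = 1).
pose unit (x : B) : bool := if dec x then true else false.
pose inv (x : B) := if dec x is left ex then sval (constructive_indefinite_description _ ex) else x.
have mulVx : {in unit, left_inverse 1 inv *%R}.
  move=> x; rewrite unfold_in /unit /inv; case: (dec x) => // ex _.
  exact: svalP (constructive_indefinite_description _ ex).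
have unitPl x z : z * x = 1 -> unit x.
  by rewrite /unit => zx; case: (dec x) => // ne; case: ne; exists z.
have invr_out : {in [predC unit], inv =1 id}.
  by move=> x; rewrite inE unfold_in /unit /inv; case: (dec x).
have dom' (x z : B) : x * z = 0 -> (x == 0) || (z == 0).
  by move=> /dom[->|->]; rewrite eqxx ?orbT.
pose M1 := GRing.ComNzRing_hasMulInverse.Build B mulVx unitPl invr_out.
pose U : comUnitRingType := HB.pack A B M1.
pose M2 := GRing.ComUnitRing_isIntegral.Build U dom'.
by exists (HB.pack A U M2 : idomainType).
Qed.

Section IntegralGenerators.
Variables (B T : comNzRingType) (g : {rmorphism B -> T}).
Let image z := exists s, g s = z.

(** Gives access to the closure of [integralOver] under sums and products. *)
Lemma integral_over_image x : integral_over_sub image x <-> integralOver g x.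
Proof.
split.
- move=> [d [c [hc e]]].
  pose c' i := sval (constructive_indefinite_description _ (hc i)).
  have gc i : g (c' i) = c i := svalP (constructive_indefinite_description _ (hc i)).
  pose r : {poly B} := \sum_(i < d) c' i *: 'X^i.
  have sz : (size r < size ('X^d : {poly B}))%N.
    by rewrite size_polyXn ltnS /r -poly_def size_poly.
  exists ('X^d + r).
    by rewrite monicE lead_coefDl // lead_coefXn.
  rewrite /root /r rmorphD rmorph_sum /= map_polyXn hornerD hornerXn horner_sum -[X in _ == X]e.
  apply/eqP; congr (_ + _); apply: eq_bigr => i _.
  by rewrite map_polyZ map_polyXn hornerZ hornerXn /= gc.
- move=> [q mq /eqP rq]; have q0 : (0 < size q)%N by rewrite size_poly_gt0 monic_neq0.
  exists (size q).-1, (fun i => g q`_i); split; first by move=> i; exists q`_i.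
  transitivity (map_poly g q).[x]; last exact: rq.
  rewrite (@horner_coef_wide _ (size q).-1.+1); last by rewrite prednK ?size_poly.
  rewrite big_ord_recr /=.
  rewrite [LHS]addrC; congr (_ + _); first by apply: eq_bigr => i _; rewrite coef_map.
  by rewrite coef_map /= -lead_coefE (monicP mq) rmorph1 mul1r.
Qed.

End IntegralGenerators.

Section IntegralForms.
Variables (A : comNzRingType) (N : lmodType A) (n : nat) (f : N -> 'I_n -> A).
Variables (t : nat) (u : 'I_t -> N) (U : N -> Prop).
Hypothesis uU : forall i, U (u i).
Local Notation T := {mpoly A[n]}.

(** Its image is the subalgebra generated by the forms of the [u i]; as the image of a ring morphism
    it fits [integralOver]. *)
Definition forms_morph : {mpoly A[t]} -> T := mmap (@mpolyC n A) (fun i => lform (f (u i))).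

HB.instance Definition _ := GRing.RMorphism.copy forms_morph
  (mmap (@mpolyC n A) (fun i => lform (f (u i)))).

Definition forms_image z := exists s, forms_morph s = z.

Lemma forms_image_sub z : forms_image z ->
  gen_subalg (fun q => exists x, U x /\ q = lform (f x)) z.
Proof.
move=> [s <-] P PC PU PD PM; rewrite /forms_morph /mmap.
have P0 : P 0 by have := PC 0; rewrite mpolyC0.
apply: big_ind => // m _; apply: (PM) => //; rewrite /mmap1.
have P1 : P 1 by have := PC 1; rewrite mpolyC1.
apply: big_ind => // i _; elim: (m i) => [|k IH]; rewrite ?expr0 // exprS.
by apply: (PM) => //; apply: PU; exists (u i).
Qed.

(** Integral elements form a subring, so if all forms of degree one were integral, the algebra they
    generate would be too. *)
Lemma exists_nonintegral_form : 
  ~ (forall q, gen_subalg (fun q' => exists x : N, True /\ q' = lform (f x)) q ->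
     integral_over_sub (gen_subalg (fun q' => exists x, U x /\ q' = lform (f x))) q) ->
  exists y, ~ integral_over_sub forms_image (lform (f y)).
Proof.
move=> nint; apply: NNPP => h; apply: nint => q hq.
have fint x : integralOver forms_morph (lform (f x)).
  by apply/integral_over_image; apply: NNPP => h'; apply: h; exists x.
have : integralOver forms_morph q.
  apply: hq => [a|q' [x [_ ->]]||] //; last exact: integral_mul; last exact: integral_add.
  have <- : forms_morph a%:MP = a%:MP by apply: mmapC.
  exact: integral_id.
move=> /integral_over_image[d [c [hc e]]]; exists d, c; split=> // i.
exact: forms_image_sub.
Qed.

End IntegralForms.

Lemma domain_case (R : comPzRingType) (A : comNzRingType) (N : lmodType A) (gens : seq N)
    (t : nat) (u : 'I_t -> N) (U : N -> Prop) :
    (forall x z : A, x * z = 0 -> x = 0 \/ z = 0) ->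
    universally_catenary R -> acc_seq A -> (exists phi : {rmorphism R -> A}, fg_algebra phi) ->
    (forall x, span gens x) -> (forall i, U (u i)) -> ~ integral_in U (fun _ => True) ->
    (exists2 a, a <> 0 & forall x, mspan u (a *: x)) ->
  exists c v P, [/\ is_prime P, ~ has_chain_len (fun z : A => z = 0) P c.+2,
      forall a, (forall x, mspan u (a *: x)) -> P a, (size v + c = t)%N &
      forall i, exists2 a, a <> 0 & span v (a *: u i)].
Proof.
move=> /idomain_structure[D eD]; case: A / eD N gens u U => N gens u U.
move=> ucat acc fg gen_all uU nint [a0 a0n0 ha0].
have [n [f [femb nintf]]] : exists n (f : N -> 'I_n -> D), rees_embedding f /\
    ~ (forall q, gen_subalg (fun q' => exists x : N, True /\ q' = lform (f x)) q ->
     integral_over_sub (gen_subalg (fun q' => exists x, U x /\ q' = lform (f x))) q).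
  apply: NNPP => h; apply: nint => n f femb; apply: NNPP => h'; apply: h.
  by exists n, f.
have [y hy] := exists_nonintegral_form uU nintf.
pose C := @forms_image D N n f t u.
pose l := [seq u i | i <- enum 'I_t].
have span_l x : mspan u x -> span (l ++ [::]) x.
  move=> [c ->]; have [S0 SD SZ] := pspan_submod (fun _ => True) (l ++ [::]).
  apply: big_ind => // i _; apply: SZ; apply: span_mem.
  by rewrite cats0; apply: map_f; rewrite mem_enum.
(* Nothing is adjoined yet: the ring is the domain itself and the kernel is zero. *)
have adj : @adjoined R D N n f C D idfun (@mpolyC n D) [::].
  split=> //; first by move=> z; exists z%:MP; apply: mmapC.
  by move=> c _ z; apply: shiftC.
have CC a : C a%:MP by exists a%:MP; apply: mmapC.
have CD x z : C x -> C z -> C (x + z) by move=> [s <-] [s' <-]; exists (s + s'); rewrite rmorphD.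
have CM x z : C x -> C z -> C (x * z) by move=> [s <-] [s' <-]; exists (s * s'); rewrite rmorphM.
have Cl x : x \in l -> C (lform (f x)).
  by move=> /mapP[i _ ->]; exists 'X_i; rewrite /= /forms_morph mmapX mmap1U.
have hl : exists2 a, a != 0 & span (l ++ [::]) (a *: y).
  by exists a0; [apply/eqP|apply: span_l].
have [c [v [P [Pprime _ nch colP [sv hv]]]]] := adjoin_all ucat gen_all femb CC CD CM hy adj Cl hl.
exists c, v, P; split=> //.
- move=> hc; apply: nch; apply: has_chain_len_mono hc => // z /eqP.
  by rewrite mpolyC_eq0 => /eqP.
- by move=> a ha; apply: colP; apply: span_l.
- by rewrite sv size_map size_enum_ord.
- move=> i; have [|a a1 ha] := hv (u i); first by apply: map_f; rewrite mem_enum.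
  by exists a; [apply/eqP|rewrite -[v]cats0].
Qed.

Section Descent.
Variables (R : comPzRingType) (Q : R -> Prop) (A : comNzRingType) (pi : {rmorphism R -> A}).
Hypotheses (Qprime : is_prime Q) (hpi : is_quotient_ring Q pi).

Lemma quotient_domain (x z : A) : x * z = 0 -> x = 0 \/ z = 0.
Proof.
have [_ _ Qpr] := Qprime; have [sur ker] := hpi.
have [r <-] := sur x; have [s <-] := sur z.
by rewrite -rmorphM => /ker/Qpr[/ker|/ker]; [left|right].
Qed.

Lemma quotient_acc : acc_seq R -> acc_seq A.
Proof.
have [sur ker] := hpi; move=> acc a.
pose b i := sval (constructive_indefinite_description _ (sur (a i))).
have hb i : pi (b i) = a i := svalP (constructive_indefinite_description _ (sur (a i))).
have [m hm] := acc b; exists m; rewrite -hb.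
have [I0 ID IM] := igen_ideal [seq a i | i <- iota 0 m].
apply: (@igen_min _ _ (fun r => igen [seq a i | i <- iota 0 m] (pi r))) hm.
  split; first by rewrite rmorph0.
    by move=> x z h1 h2; rewrite rmorphD; apply: ID.
  by move=> r x h; rewrite rmorphM; apply: IM.
by move=> x /mapP[i hi ->]; rewrite hb; apply: igen_mem; apply: map_f.
Qed.

Lemma quotient_fg : fg_algebra pi.
Proof.
exists 0%N, (fun _ => 0) => z P Ppi _ _ _; have [sur _] := hpi.
by have [r <-] := sur z.
Qed.

Lemma preimage_prime P : is_prime P -> is_prime (fun r => P (pi r)).
Proof.
move=> [[P0 PD PM] P1 Ppr]; split; [split|by rewrite rmorph1|].
- by rewrite rmorph0.
- by move=> x z h1 h2; rewrite rmorphD; apply: PD.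
- by move=> r x h; rewrite rmorphM; apply: PM.
- by move=> x z; rewrite rmorphM; apply: Ppr.
Qed.

Lemma quotient_chain P n :
  has_chain_len Q (fun r => P (pi r)) n -> has_chain_len (fun z => z = 0) P n.
Proof.
have [sur ker] := hpi; move=> [C [[CP CS] h]].
pose D i z := exists2 r, pi r = z & C i r.
have QC i : (i <= n)%N -> subp Q (C i) by move=> /h[].
have DC i r : (i <= n)%N -> D i (pi r) -> C i r.
  move=> le [s e Cs]; have [[C0 CD CM] _ _] := CP i le.
  rewrite -[r](subrK s); apply: CD => //; apply: QC => //.
  by apply/ker; rewrite rmorphB e subrr.
exists D; split; first split.
- move=> i le; have [[C0 CD CM] C1 Cpr] := CP i le; split; first split.
  + by exists 0; rewrite ?rmorph0.
  + by move=> x z [r <- hr] [s <- hs]; exists (r + s); [rewrite rmorphD|apply: CD].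
  + by move=> x z [r <- hr]; have [s <-] := sur x; exists (s * r); [rewrite rmorphM|apply: CM].
  + by rewrite -(rmorph1 pi) => /(DC _ _ le).
  + move=> x z; have [r <-] := sur x; have [s <-] := sur z.
    by rewrite -rmorphM => /(DC _ _ le)/Cpr[hr|hs]; [left; exists r|right; exists s].
- move=> i lt; have [h1 h2] := CS i lt; split.
    by move=> z [r <- hr]; exists r => //; apply: h1.
  by move=> h3; apply: h2 => r hr; apply: (DC _ _ (ltnW lt)); apply: h3; exists r.
- move=> i le; split; first by move=> z ->; exists 0; rewrite ?rmorph0 //; case: (CP i le) => [[]].
  by move=> z [r <- hr]; have [_ h2] := h i le; apply: h2.
Qed.

End Descent.

(* Extend a chain from [P] to a maximal ideal, use equidimensionality there, and cut it back. *)
Lemma chain_from_minimal_prime (R : comPzRingType) (Q P : R -> Prop) h :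
    noetherian R -> catenary R -> locally_equidimensional R ->
    is_minimal_prime Q -> is_prime P -> subp Q P ->
  has_chain_len botp P h -> has_chain_len Q P h.
Proof.
move=> noe cat equi Qmin Pprime QP hc; have [hP P1 _] := Pprime.
have [m [mmax Pm]] := acc_maximal (noetherian_acc noe) hP P1.
have mprime := maximal_prime mmax; have [Qprime _] := Qmin.
have [n [k [ln [lk nk] lnk]]] := catenary_chain_length cat Qprime Pprime mprime QP Pm.
have Qm : subp Q m by move=> x /QP/Pm.
have := equi _ _ mmax Qmin Qm _ (has_chain_len_cat hc lk).
move=> /(chain_length_max lnk); rewrite leq_add2r => le.
by case: ln => hn _; apply: has_chain_len_le hn.
Qed.

Theorem theorem1p2 (R : comPzRingType) (M : lmodType R) (t : nat)
  (u : 'I_t -> M) (Q : R -> Prop) (A : comNzRingType)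
  (pi : {rmorphism R -> A}) (N : lmodType A) (p : M -> N) (mu : nat) :
  noetherian R -> universally_catenary R -> locally_equidimensional R ->
  fg_module M ->
  is_minimal_prime Q -> is_quotient_ring Q pi -> is_quotient_module Q pi p ->
  ~ integral_in (fun y => exists x, mspan u x /\ y = p x) (fun _ => True) ->
  is_mu M Q mu ->
  height_le (colon (mspan u)) ((t + 1) - mu)%N.
Proof.
move=> noe ucat equi [l [g hg]] Qmin hpi hp nint [_ mu_min].
have [Qprime Qleast] := Qmin; have [[Q0 QD QMul] Q1 Qpr] := Qprime.
have [sur ker] := hpi; have [pD pZ psur pker] := hp.
(* If the colon ideal lies in [Q], then [Q] itself is the required prime: minimality excludes even a
   chain of length one. *)
have [[s0 s0col nQs0]|h] := classic (exists2 s, colon (mspan u) s & ~ Q s); last first.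
  exists Q; split=> //; first by move=> s hs; apply: NNPP => nQs; apply: h; exists s.
  move=> [C [[CP CS] hC]]; have [_ n01] := CS 0%N isT; apply: n01 => x.
  have [_ C1Q] := hC 1%N isT; have [_ C0Q] := hC 0%N isT.
  by move=> /C1Q; apply: (Qleast (C 0%N)) => //; apply: CP.
have p0 : p 0 = 0 by have := pZ 0 0; rewrite scale0r rmorph0 scale0r.
have p_sum k (c : 'I_k -> R) (x : 'I_k -> M) :
    p (\sum_(i < k) c i *: x i) = \sum_(i < k) pi (c i) *: p (x i).
  elim/big_rec2: _ => [|i y1 y2 _ <-]; last by rewrite pD pZ.
  exact: p0.
pose gM := [seq g i | i <- enum 'I_l].
have gM_span x : span gM x.
  have [c ->] := hg x; have [S0 SD SZ] := pspan_submod (fun _ => True) gM.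
  by apply: big_ind => // i _; apply: SZ; apply: span_mem; apply: map_f; rewrite mem_enum.
have pspan_all y : span [seq p x | x <- gM] y.
  have [x <-] := psur y; have [S0 SD SZ] := pspan_submod (fun _ => True) [seq p x | x <- gM].
  apply: (@span_min _ _ gM (fun x => span [seq p x | x <- gM] (p x))) (gM_span x).
    split; first by rewrite p0.
      by move=> x1 x2; rewrite pD; apply: SD.
    by move=> r x1; rewrite pZ; apply: SZ.
  by move=> x1 h1; apply: span_mem; apply: map_f.
pose u' i := p (u i).
have col_p r : colon (mspan u) r -> forall y, mspan u' (pi r *: y).
  move=> hr y; have [x <-] := psur y; have [c e] := hr x.
  by exists (fun i => pi (c i)); rewrite -pZ e p_sum.
have uU i : exists x, mspan u x /\ u' i = p x.
  exists (u i); split=> //; exists (fun j => (j == i)%:R).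
  rewrite (bigD1 i) //= eqxx scale1r big1 ?addr0 // => j /negPf->.
  by rewrite scale0r.
have col0 : exists2 a, a <> 0 & forall y, mspan u' (a *: y).
  by exists (pi s0); [move/ker|apply: col_p].
have [c [v [P [Pprime nch colP sv hv]]]] := domain_case (quotient_domain Qprime hpi) ucat
  (quotient_acc hpi (noetherian_acc noe)) (ex_intro _ _ (quotient_fg hpi)) pspan_all uU nint col0.
(* Lifts of [v] generate M_Q: [s0] carries M into U, a lift [r] of a common nonzero multiplier
   carries U into their span modulo QM, and Nakayama at [Q] removes QM. *)
have le_mu : (mu <= size v)%N.
  have [a a0 ha] : exists2 a, a <> 0 & forall i, span v (a *: u' i).
    have hv' i : exists a, a <> 0 /\ span v (a *: u' i).
      by have [a a0 ha] := hv i; exists a.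
    pose b i := sval (constructive_indefinite_description _ (hv' i)).
    have [b0 hb] : (forall i, b i <> 0) /\ forall i, span v (b i *: u' i).
      by split=> i; have [] := svalP (constructive_indefinite_description _ (hv' i)).
    exists (\prod_i b i) => [|i].
      apply: (big_ind (fun z => z <> 0)) => [|x z x0 z0 /(quotient_domain Qprime hpi)[]|] //.
      by move/eqP; rewrite oner_eq0.
    have [_ _ SZ] := pspan_submod (fun _ => True) v.
    by rewrite (bigD1 i) //= mulrC -scalerA; apply: (SZ); apply: hb.
  pose lft y := sval (constructive_indefinite_description _ (psur y)).
  have plft y : p (lft y) = y := svalP (constructive_indefinite_description _ (psur y)).
  pose w := [seq lft y | y <- v].
  have [W0 WD WZ] := pspan_submod (fun _ => True) w.
  have span_lift y : span v y -> exists2 x, span w x & p x = y.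
    apply: (@span_min _ _ v (fun y => exists2 x, span w x & p x = y)); first split.
    - by exists 0.
    - by move=> y1 y2 [x1 h1 <-] [x2 h2 <-]; exists (x1 + x2); [apply: WD|rewrite pD].
    - move=> z y1 [x1 h1 <-]; have [r <-] := sur z.
      by exists (r *: x1); [apply: WZ|rewrite pZ].
    - by move=> y1 h1; exists (lft y1); [apply: span_mem; apply: map_f|apply: plft].
  have [r er] := sur a.
  have nQr : ~ Q r by move=> /ker; rewrite er.
  have [G0 GD GZ] := pspan_submod Q gM.
  have QM_span x : QM Q x -> pspan Q gM x.
    move=> [k [q [m [hq ->]]]]; apply: big_ind => // i _.
    apply: (@span_min _ _ gM (fun x => pspan Q gM (q i *: x))) (gM_span (m i)).
      split; first by rewrite scaler0.
        by move=> x1 x2 h1 h2; rewrite scalerDr; apply: GD.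
      by move=> z x1 h1; rewrite scalerA mulrC -scalerA; apply: GZ.
    by move=> x1 h1; apply: pspan_scale.
  have [x _|d nQd hd] := nakayama (s := gM) Qprime (pspan_submod (fun _ => True) w).
    exists (r * s0); first by move=> /Qpr[].
    have [z wz pz] : exists2 z, span w z & p z = p ((r * s0) *: x).
      apply: span_lift; rewrite -scalerA pZ er; have [cc ->] := s0col x; rewrite p_sum.
      rewrite scaler_sumr; have [S0 SD SZ] := pspan_submod (fun _ => True) v.
      apply: big_ind => // i _; rewrite scalerA mulrC -scalerA; apply: SZ; exact: ha.
    exists z => //; apply: QM_span; apply/pker.
    by rewrite pD -[- z]scaleN1r [p (-1 *: z)]pZ pz rmorphN rmorph1 scaleN1r subrr.
  rewrite -(size_map lft v) -/w; apply: mu_min; exists (fun i : 'I_(size w) => w`_i) => m.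
  exists d; split=> //; apply/span_mspan.
  apply: (@span_min _ _ gM (fun x => span w (d *: x))) (gM_span m) => //; split.
  - by rewrite scaler0.
  - by move=> x1 x2 h1 h2; rewrite scalerDr; apply: WD.
  - by move=> z x1 h1; rewrite scalerA mulrC -scalerA; apply: WZ.
have PRprime := preimage_prime pi Pprime.
exists (fun r => P (pi r)); split=> //; first by move=> r /col_p/colP.
move=> hc; apply: nch; apply: (quotient_chain hpi).
apply: (chain_from_minimal_prime noe (ucat _ idfun _) equi Qmin PRprime).
- by exists 0%N, (fun _ => 0) => z V Vpi _ _ _; apply: Vpi.
- by move=> r /ker e; rewrite e; case: Pprime => [[]].
(* Since c = t - size v and mu is at most size v, which is at most t, the truncated t + 1 - mu is at
   least c + 1. *)
- by apply: has_chain_len_le hc; lia.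
Qed.
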